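(* Consider on the real line $x\in\mathbb{R}$ the equation $$\omega_t=-\tfrac12\,u\,\omega_x+\omega\,\mathcal{H}(\omega)-\nu\Lambda\omega,\qquad u_x=\mathcal{H}\omega ,\qquad \nu>0.$$ (i) Let $x_0\in\mathbb{R}$ and let $v_c(t)>0$ and $\omega_{-2}(t)\ne0$ be real functions satisfying $$\frac{dv_c}{dt}=-\left(\frac{\omega_{-2}}{4v_c}-\nu\right),\qquad \frac{d\omega_{-2}}{dt}=\frac{\omega_{-2}^2}{4v_c^2}.$$ Then $$\omega(x,t)=i\,\omega_{-2}(t)\left(\frac{1}{[x-x_0-iv_c(t)]^2}-\frac{1}{[x-x_0+iv_c(t)]^2}\right),\qquad u(x,t)=\omega_{-2}(t)\left(\frac1{x-x_0-iv_c(t)}+\frac1{x-x_0+iv_c(t)}\right)$$ is an exact solution of the equation. Its norms are, with $\Omega(t)=\omega_{-2}(t)/v_c(t)$, $$\|\omega(\cdot,t)\|_{L^\infty}=\frac{3\sqrt3}{4}\frac{|\Omega(t)|}{v_c(t)},\qquad \|\omega(\cdot,t)\|_{L^2}=\sqrt\pi\,\frac{|\Omega(t)|}{\sqrt{v_c(t)}} .$$ (ii) Let $\nu=1$. If $\Omega(0)>2$, there is finite-time blow-up: there is a finite $t_c>0$ with $v_c(t)\to0$ as $t\to t_c^-$; moreover, for some constant $\widetilde v_c>0$, $v_c(t)\sim\widetilde v_c\,(t_c-t)^{1/3}$ and $\omega_{-2}(t)\sim\frac{4\widetilde v_c^2}{3}(t_c-t)^{-1/3}$ as $t\to t_c^-$.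 If $\Omega(0)\le2$, the solution exists and is analytic in $x\in\mathbb{R}$ for all $t>0$, and $v_c(t)$ is increasing for all $t>0$. (iii) Let $\nu=1$. For every $\epsilon>0$ there are initial data of the form $$\omega(x,0)=i\,\omega_{-2}(0)\left(\frac{1}{[x-x_0-iv_c(0)]^2}-\frac{1}{[x-x_0+iv_c(0)]^2}\right),\qquad x_0\in\mathbb{R},\ v_c(0)>0,\ \omega_{-2}(0)\in\mathbb{R}\setminus\{0\},$$ with $\|\omega(\cdot,0)\|_{L^2}<\epsilon$ and $\|\omega(\cdot,0)\|_{L^\infty}<\epsilon$ for which the solution blows up in finite time.
   Context: On the real line $\mathcal{H}f(x)=\frac1\pi\,\mathrm{PV}\int_{-\infty}^\infty\frac{f(x')}{x-x'}\,dx'$ (Fourier symbol $-i\,\mathrm{sgn}(k)$), and $\Lambda=\mathcal{H}\partial_x$ (symbol $|k|$). This is the generalized Constantin–Lax–Majda equation $\omega_t=-au\omega_x+\omega\mathcal{H}(\omega)-\nu\Lambda^\sigma\omega$ with $a=1/2$, $\sigma=1$. *)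

(* Defs.v *)
From HB Require Import structures.
From mathcomp Require Import all_boot all_order all_algebra.
From mathcomp Require Import all_classical all_reals all_analysis.
From mathcomp Require Import complex.

Set Implicit Arguments.
Unset Strict Implicit.
Unset Printing Implicit Defensive.

Import Order.TTheory GRing.Theory Num.Theory.
Import numFieldNormedType.Exports.

Local Open Scope classical_set_scope.
Local Open Scope ring_scope.

Section HilbertTransform.
Context {R : realType}.
Implicit Types (f : R -> R) (x e : R).

Definition pv_domain x e : set R := [set y | e < `|x - y|].

Definition hilbert_trunc f x e : R :=
  pi^-1 * \int[lebesgue_measure]_(y in pv_domain x e) (f y / (x - y)).

(* Only the singularity y = x is treated as a principal value: at infinity the
   integral is required to converge absolutely. *)
Definition has_hilbert f x : Prop :=
  (forall e, 0 < e ->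
     lebesgue_measure.-integrable (pv_domain x e)
       (EFin \o (fun y => f y / (x - y)))) /\
  cvg (hilbert_trunc f x e @[e --> 0^'+]).

(* Meaningful at x only when has_hilbert f x. *)
Definition hilbert f x : R := lim (hilbert_trunc f x e @[e --> 0^'+]).

(* The operator of symbol |k|. *)
Definition Lambda f : R -> R := hilbert (derive1 f).

End HilbertTransform.

Section Equation.
Context {R : realType}.

(* Classical solutions on R x J of
     omega_t = - u omega_x / 2 + omega H(omega) - nu Lambda omega,
     u_x = H(omega).
   Functions are written omega x t.  J may contain its endpoints: there the
   evolution equation is replaced by continuity up to the endpoint, so that an
   initial condition at the left endpoint is meaningful. *)
Definition is_solution (nu : R) (J : set R) (omega u : R -> R -> R) : Prop :=
  [/\ {within [set p : R * R | J p.2],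
         continuous (fun p : R * R => omega p.1 p.2)},
      forall x t, J t ->
        [/\ derivable (omega ^~ t) x 1,
            has_hilbert (omega ^~ t) x &
            is_derive x 1 (u ^~ t) (hilbert (omega ^~ t) x)] &
      forall x t, J° t ->
        has_hilbert (derive1 (omega ^~ t)) x /\
        is_derive t 1 (omega x)
          (- (1 / 2) * u x t * derive1 (omega ^~ t) x
           + omega x t * hilbert (omega ^~ t) x
           - nu * Lambda (omega ^~ t) x)].

Definition norm_Loo (f : R -> R) : \bar R :=
  'N[lebesgue_measure]_+oo%E [EFin \o f]%E.

Definition norm_L2 (f : R -> R) : \bar R :=
  'N[lebesgue_measure]_2%:E [EFin \o f]%E.

Definition blows_up_at (omega : R -> R -> R) (tc : R) : Prop :=
  norm_Loo (omega ^~ t) @[t --> tc^'-] --> +oo%E.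

Definition real_analytic_at (f : R -> R) (x : R) : Prop :=
  exists (c : R^nat) (r : R), 0 < r /\
    forall y, `|y - x| < r ->
      series (fun k => c k * (y - x) ^+ k) @ \oo --> f y.

End Equation.

Section Poles.
Context {R : realType}.
Local Open Scope complex_scope.

Definition omega_cplx (x0 v w x : R) : R[i] :=
  'i * w%:C * ((((x - x0)%:C - 'i * v%:C) ^+ 2)^-1
               - (((x - x0)%:C + 'i * v%:C) ^+ 2)^-1).

Definition u_cplx (x0 v w x : R) : R[i] :=
  w%:C * (((x - x0)%:C - 'i * v%:C)^-1 + ((x - x0)%:C + 'i * v%:C)^-1).

(* For real v and w the two values above are real; taking real parts makes
   them elements of R. *)
Definition omega_prof (x0 v w x : R) : R := complex.Re (omega_cplx x0 v w x).
Definition u_prof (x0 v w x : R) : R := complex.Re (u_cplx x0 v w x).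

Definition omega_pole (x0 : R) (v w : R -> R) (x t : R) : R :=
  omega_prof x0 (v t) (w t) x.
Definition u_pole (x0 : R) (v w : R -> R) (x t : R) : R :=
  u_prof x0 (v t) (w t) x.

Definition Omega (v w : R -> R) (t : R) : R := w t / v t.

(* v and w stand for v_c and omega_{-2}; endpoints of J are treated as in
   is_solution. *)
Definition pole_flow (nu : R) (J : set R) (v w : R -> R) : Prop :=
  [/\ forall t, J t -> 0 < v t /\ w t != 0,
      {within J, continuous v},
      {within J, continuous w} &
      forall t, J° t ->
        is_derive t 1 v (- (w t / (4 * v t) - nu)) /\
        is_derive t 1 w (w t ^+ 2 / (4 * v t ^+ 2))].

(* [0, T), with T possibly +oo *)
Definition lifespan (T : \bar R) : set R :=
  [set t | 0 <= t /\ (t%:E < T)%E].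

(* (v, w) is the solution of the initial value problem (v0, w0), and [0, T) is
   its maximal interval of existence forward in time. *)
Definition maximal_pole_flow (nu : R) (T : \bar R) (v0 w0 : R)
    (v w : R -> R) : Prop :=
  [/\ pole_flow nu (lifespan T) v w, v 0 = v0, w 0 = w0 &
      forall (T' : \bar R) (v' w' : R -> R),
        pole_flow nu (lifespan T') v' w' -> v' 0 = v0 -> w' 0 = w0 ->
        (T' <= T)%E /\
        forall t, lifespan T' t -> v' t = v t /\ w' t = w t].

End Poles.

(* Main.v *)
Require Import Defs.
From HB Require Import structures.
From mathcomp Require Import all_boot all_order all_algebra.
From mathcomp Require Import all_classical all_reals all_analysis.
From mathcomp Require Import complex.
From mathcomp Require Import measurable_realfun ess_sup_inf ring lra.

Set Implicit Arguments.
Unset Strict Implicit.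
Unset Printing Implicit Defensive.

Import Order.TTheory GRing.Theory Num.Theory.
Import numFieldNormedType.Exports.

Local Open Scope classical_set_scope.
Local Open Scope ring_scope.

(** Write [z = x - x0] and [D = z^2 + v^2].  The complex formulas reduce to
    [omega = - 4 w v z / D^2] and [u = 2 w z / D], rational functions of [x] with
    poles [x0 + i v] and [x0 - i v].

    Hilbert transforms.  When [f] is such a rational function, partial fractions
    in [y] give, with [z] and [D] now taken at [y] instead of [x],
      [f y / (x - y) = al (1 / (x - y) + z / D) + be v / D + P'(y)]
    with [P] a rational function vanishing at infinity.  The first term has the
    primitive [al (ln D - ln (x - y)^2) / 2], which tends to [0] at infinity and
    whose singularity at [x] cancels in the symmetric limit, and the second has
    the primitive [be atan (z / v)].  Hence [H f x = be] ([hilbert_rational]).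
    Applied to [omega] and [omega_x] ([hilbert_dipole], [hilbert_quadrupole])
    this turns the partial differential equation into a polynomial identity in
    [z], whose coefficients vanish by the two ordinary differential equations
    ([pole_solution]).  The sup norm comes from the maximum at
    [z = v / sqrt 3], the L2 norm from a primitive of [omega^2].

    The flow with [nu = 1].  The quantity [k = (w / v - 2) / w^2] is conserved
    ([invariant_constant]), so that [w / v = 2 + k w^2] and
    [w' = (2 + k w^2)^2 / 4].  The flow is therefore solved by a clock: a function
    [f] with [f'(y) = 4 / (2 + k y^2)^2] satisfies [f (w t) = f (w 0) + t].
    Inverting [f] on the interval that [w] cannot leave gives at once existence,
    uniqueness and the maximal lifespan ([maximal_flow_of_clock]).

    If [w0 / v0 <= 2] then [k <= 0], the clock is unbounded because [v] can be
    made arbitrarily large and its growth rate is bounded ([clock_unbounded]),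
    and [v' = 1 - (w / v) / 4 >= 1 / 2].  If [w0 / v0 > 2] then [k > 0] and the
    clock has a finite limit [l] at infinity, so [tc = l - f w0].  Comparing
    [4 / (2 + k y^2)^2] with [4 / (k y^2)^2] shows that [tc - t] is equivalent to
    [4 / (3 k^2 w^3)], whence the exponents [1/3] and [- 1/3]
    ([blowup_asymptotics]).  Small data that blow up are obtained with
    [w0 / v0 = 3] and [v0] large, since both norms decay as [v0] grows at fixed
    [w0 / v0]. *)

(** * Derivatives of explicit functions *)

Section DerivativeRules.
Context {R : realType}.
Implicit Types (f g : R -> R) (x y a b : R).

Lemma der_eq f x a b : is_derive x 1 f a -> a = b -> is_derive x 1 f b.
Proof. by move=> h <-. Qed.

Lemma der_cst a x : is_derive x 1 (fun=> a) 0.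
Proof. exact: is_derive_cst. Qed.

Lemma der_id x : is_derive x 1 (fun y : R => y) 1.
Proof. exact: is_derive_id. Qed.

Lemma derD f g x a b : is_derive x 1 f a -> is_derive x 1 g b ->
  is_derive x 1 (fun y => f y + g y) (a + b).
Proof. by move=> fa gb; exact: is_deriveD. Qed.

Lemma derN f x a : is_derive x 1 f a -> is_derive x 1 (fun y => - f y) (- a).
Proof. by move=> fa; exact: is_deriveN. Qed.

Lemma derM f g x a b : is_derive x 1 f a -> is_derive x 1 g b ->
  is_derive x 1 (fun y => f y * g y) (a * g x + f x * b).
Proof.
move=> fa gb; apply: (is_derive_eq (is_deriveM fa gb)).
by rewrite /GRing.scale /=; ring.
Qed.

Lemma derX f n x a : is_derive x 1 f a ->
  is_derive x 1 (fun y => f y ^+ n) (n%:R * f x ^+ n.-1 * a).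
Proof.
move=> fa; elim: n => [|n IH].
  by rewrite !mul0r; under eq_fun do rewrite expr0; exact: der_cst.
under eq_fun do rewrite exprS.
apply: (der_eq (derM fa IH)).
by case: n {IH} => [|n] /=; rewrite ?expr0 ?exprS -?natr1; ring.
Qed.

Lemma derV f x a : f x != 0 -> is_derive x 1 f a ->
  is_derive x 1 (fun y => (f y)^-1) (- a / f x ^+ 2).
Proof.
move=> fx0 fa; apply: (is_derive_eq (is_deriveV fx0 fa)).
by rewrite /GRing.scale /= expr2; field.
Qed.

Lemma der_comp f g x a b : is_derive x 1 g b -> is_derive (g x) 1 f a ->
  is_derive x 1 (fun y => f (g y)) (a * b).
Proof. by move=> gb fa; exact: is_derive1_comp. Qed.

Lemma der_ln f x a : 0 < f x -> is_derive x 1 f a ->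
  is_derive x 1 (fun y => ln (f y)) (a / f x).
Proof.
move=> fx0 fa; rewrite mulrC; apply: (der_comp fa); exact: is_derive1_ln.
Qed.

Lemma der_atan f x a : is_derive x 1 f a ->
  is_derive x 1 (fun y => atan (f y)) (a / (1 + f x ^+ 2)).
Proof.
move=> fa; rewrite mulrC; apply: (der_comp fa); exact: is_derive1_atan.
Qed.

Lemma der_continuous f x a : is_derive x 1 f a -> {for x, continuous f}.
Proof.
move=> fa; apply/differentiable_continuous/derivable1_diffP.
by apply: ex_derive.
Qed.

End DerivativeRules.

(** Derivative of an explicit expression, by recursion on its shape; the
    remaining goals are the side conditions, then the equality between the
    computed derivative and the expected one.  Since [is_derive] is a class,
    [notypeclasses refine] keeps instance resolution from instantiating the
    unknown derivative. *)
Ltac deriv_rules :=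
  lazymatch goal with
  | |- is_derive _ _ (fun=> ?c) _ => exact: der_cst
  | |- is_derive _ _ (fun y => y) _ => exact: der_id
  | |- is_derive _ _ (fun y => @?f y + @?g y) _ =>
      notypeclasses refine (@derD _ f g _ _ _ _ _); deriv_rules
  | |- is_derive _ _ (fun y => - @?f y) _ =>
      notypeclasses refine (@derN _ f _ _ _); deriv_rules
  | |- is_derive _ _ (fun y => @?f y * @?g y) _ =>
      notypeclasses refine (@derM _ f g _ _ _ _ _); deriv_rules
  | |- is_derive _ _ (fun y => (@?f y) ^+ ?n) _ =>
      notypeclasses refine (@derX _ f n _ _ _); deriv_rules
  | |- is_derive _ _ (fun y => (@?f y)^-1) _ =>
      notypeclasses refine (@derV _ f _ _ _ _); [|deriv_rules]
  | |- is_derive _ _ (fun y => ln (@?f y)) _ =>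
      notypeclasses refine (@der_ln _ f _ _ _ _); [|deriv_rules]
  | |- is_derive _ _ (fun y => atan (@?f y)) _ =>
      notypeclasses refine (@der_atan _ f _ _ _); deriv_rules
  | |- is_derive _ _ _ _ => eassumption
  | |- _ => idtac
  end.
Ltac deriv := notypeclasses refine (der_eq _ _); [deriv_rules|];
  cbv beta; rewrite /=.

(** * Improper integrals *)

(** A signed integrand is integrated through nonnegative ones, as
    [f = (f + g) - g]. *)
Lemma dominated_Rintegral d (T : measurableType d) (R : realType)
    (mu : {measure set T -> \bar R}) (D : set T) (f g : T -> R) (a b : R) :
  measurable D -> measurable_fun D f -> measurable_fun D g ->
  (forall x, D x -> `|f x| <= g x) ->
  (\int[mu]_(x in D) (g x)%:E = a%:E)%E ->
  (\int[mu]_(x in D) (f x + g x)%:E = b%:E)%E ->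
  mu.-integrable D (EFin \o f) /\ \int[mu]_(x in D) f x = b - a.
Proof.
move=> mD mf mg fg ga fgb.
have g0 x : D x -> 0 <= g x by move=> /fg; exact: le_trans.
have ig : mu.-integrable D (EFin \o g).
  apply/integrableP; split; first exact/measurable_EFinP.
  suff -> : (\int[mu]_(x in D) `|(EFin \o g) x| = a%:E)%E by rewrite ltry.
  rewrite -ga; apply: eq_integral.
  by move=> x; rewrite inE => Dx /=; rewrite ger0_norm// g0.
have if_ : mu.-integrable D (EFin \o f).
  apply: le_integrable ig => //; first exact/measurable_EFinP.
  by move=> x Dx /=; rewrite lee_fin (le_trans (fg x Dx))// ler_norm.
split=> //.
have := RintegralD mD if_ ig; rewrite /Rintegral.
by rewrite fgb ga /= => ->; rewrite addrK.
Qed.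

Section ImproperIntegrals.
Context {R : realType}.
Notation mu := (@lebesgue_measure R).
Implicit Types (f g F G : R -> R) (a b l m : R).

Lemma ge0_integral_right_ray f F a l :
  (forall x, a <= x -> 0 <= f x) ->
  (forall x, a <= x -> {for x, continuous f}) ->
  (forall x, a <= x -> is_derive x 1 F (f x)) ->
  F x @[x --> +oo] --> l ->
  (\int[mu]_(x in `[a, +oo[) (f x)%:E = (l - F a)%:E)%E.
Proof.
move=> f0 cf dF Fl.
rewrite EFinB (@ge0_continuous_FTC2y _ f F a l) //.
- move=> x; apply: continuous_in_subspaceT => {}x.
  rewrite inE/= in_itv/= andbT; exact: cf.
- by move=> x /ltW /dF ?; apply: ex_derive.
- by apply: cvg_at_right_filter; apply: der_continuous (dF _ _).
- move=> x; rewrite in_itv/= andbT => /ltW /dF h.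
  by rewrite derive1E; exact: derive_val.
Qed.

Lemma cvgNy_opp F l : F x @[x --> -oo] --> l -> F (- x) @[x --> +oo] --> l.
Proof. by move/cvgNy_compNP. Qed.

Lemma ge0_integral_left_ray f F b l :
  (forall x, x <= b -> 0 <= f x) ->
  (forall x, x <= b -> {for x, continuous f}) ->
  (forall x, x <= b -> is_derive x 1 F (f x)) ->
  F x @[x --> -oo] --> l ->
  (\int[mu]_(x in `]-oo, b]) (f x)%:E = (F b - l)%:E)%E.
Proof.
move=> f0 cf dF Fl; have := @ge0_integration_by_substitutionNy R f (- b).
rewrite opprK => ->; last 2 first.
- move=> x; apply: continuous_in_subspaceT => {}x.
  rewrite inE/= in_itv/=; exact: cf.
- by move=> x; rewrite in_itv/= => /ltW/f0.
have dF' x : - b <= x -> is_derive x 1 (fun y => - F (- y)) (f (- x)).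
  rewrite lerNl => /dF h.
  have h2 : is_derive x 1 (fun y : R => - y) (-1) by apply: derN; exact: der_id.
  by apply: (der_eq (derN (der_comp h2 h))); rewrite mulrN1 opprK.
rewrite (ge0_integral_right_ray _ _ dF' (cvgN (cvgNy_opp Fl))).
- by rewrite !opprK addrC.
- by move=> x; rewrite lerNl => /f0.
- move=> x; rewrite lerNl => xb; apply: continuous_comp; last exact: cf.
  exact: opp_continuous.
Qed.

(** The fundamental theorem of calculus on a ray, for an integrand of any sign
    dominated by a function [g] that has a primitive with a limit. *)
Lemma Rintegral_right_ray f g F G a l m :
  (forall x, a <= x -> `|f x| <= g x) ->
  (forall x, a <= x -> is_derive x 1 F (f x)) ->
  (forall x, a <= x -> is_derive x 1 G (g x)) ->
  (forall x, a <= x -> {for x, continuous f}) ->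
  (forall x, a <= x -> {for x, continuous g}) ->
  F x @[x --> +oo] --> l -> G x @[x --> +oo] --> m ->
  \int[mu]_(x in `[a, +oo[) f x = l - F a.
Proof.
move=> fg dF dG cf cg Fl Gm.
have dFG x : a <= x -> is_derive x 1 (fun y => F y + G y) (f x + g x).
  by move=> ax; exact: derD (dF _ ax) (dG _ ax).
have mc (h : R -> R) : (forall x, a <= x -> {for x, continuous h}) ->
    measurable_fun `[a, +oo[ h.
  move=> ch; apply: subspace_continuous_measurable_fun => //.
  move=> x; apply: continuous_in_subspaceT => {}x.
  rewrite inE/= in_itv/= andbT; exact: ch.
have [] := @dominated_Rintegral _ _ R mu `[a, +oo[ f g (m - G a) (l + m - (F a + G a)).
- exact: measurable_itv.
- exact: mc.
- exact: mc.
- by move=> x /=; rewrite in_itv/= andbT; exact: fg.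
- by apply: (ge0_integral_right_ray _ cg dG Gm) => x /fg; exact: le_trans.
- apply: (ge0_integral_right_ray _ _ dFG (cvgD Fl Gm)).
  + by move=> x /fg; rewrite ler_norml; lra.
  + by move=> x ax; apply: cvgD; [exact: cf|exact: cg].
- by move=> _ ->; ring.
Qed.

Lemma Rintegral_left_ray f g F G b l m :
  (forall x, x <= b -> `|f x| <= g x) ->
  (forall x, x <= b -> is_derive x 1 F (f x)) ->
  (forall x, x <= b -> is_derive x 1 G (g x)) ->
  (forall x, x <= b -> {for x, continuous f}) ->
  (forall x, x <= b -> {for x, continuous g}) ->
  F x @[x --> -oo] --> l -> G x @[x --> -oo] --> m ->
  \int[mu]_(x in `]-oo, b]) f x = F b - l.
Proof.
move=> fg dF dG cf cg Fl Gm.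
have dFG x : x <= b -> is_derive x 1 (fun y => F y + G y) (f x + g x).
  by move=> ax; exact: derD (dF _ ax) (dG _ ax).
have mc (h : R -> R) : (forall x, x <= b -> {for x, continuous h}) ->
    measurable_fun `]-oo, b] h.
  move=> ch; apply: subspace_continuous_measurable_fun => //.
  move=> x; apply: continuous_in_subspaceT => {}x.
  rewrite inE/= in_itv/=; exact: ch.
have [] := @dominated_Rintegral _ _ R mu `]-oo, b] f g (G b - m) (F b + G b - (l + m)).
- exact: measurable_itv.
- exact: mc.
- exact: mc.
- by move=> x /=; rewrite in_itv/=; exact: fg.
- by apply: (ge0_integral_left_ray _ cg dG Gm) => x /fg; exact: le_trans.
- apply: (ge0_integral_left_ray _ _ dFG (cvgD Fl Gm)).
  + by move=> x /fg; rewrite ler_norml; lra.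
  + by move=> x ax; apply: cvgD; [exact: cf|exact: cg].
- by move=> _ ->; ring.
Qed.

Lemma ge0_integral_line f F l m :
  (forall x, 0 <= f x) -> continuous f ->
  (forall x : R, is_derive x 1 F (f x)) ->
  F x @[x --> -oo] --> l -> F x @[x --> +oo] --> m ->
  (\int[mu]_x (f x)%:E = (m - l)%:E)%E.
Proof.
move=> f0 cf dF Fl Fm.
have mf : measurable_fun setT (fun x => (f x)%:E).
  by apply/measurable_EFinP; exact: continuous_measurable_fun.
have -> : [set: R] = `]-oo, 0] `|` `]0, +oo[.
  apply/seteqP; split=> // x _ /=; rewrite !in_itv/= andbT.
  by case: (leP x 0) => ?; [left|right].
rewrite ge0_integral_setU//=; last 3 first.
- apply: measurable_funTS; exact: mf.
- by move=> x _; rewrite lee_fin.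
- apply/disj_setPS => x []; rewrite /= !in_itv/= andbT; lra.
rewrite (@integral_itv_obnd_cbnd _ 0); last first.
  apply/measurable_EFinP; apply: measurable_funTS.
  exact: continuous_measurable_fun.
rewrite (ge0_integral_left_ray (fun x _ => f0 x) (fun x _ => cf x) (fun x _ => dF x) Fl)//.
rewrite (ge0_integral_right_ray (fun x _ => f0 x) (fun x _ => cf x) (fun x _ => dF x) Fm)//.
by rewrite -EFinD; congr EFin; ring.
Qed.

End ImproperIntegrals.

(** * The Cauchy kernel *)

Section CauchyKernel.
Context {R : realType}.
Implicit Types (v x : R).

Lemma cvgNy_atan : (@atan R) x @[x --> -oo] --> - (pi / 2).
Proof.
apply/cvgNy_compNP; rewrite (_ : _ \o _ = (fun x => - atan x)).
  by apply: cvgN; exact: cvgy_atan.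
by apply/funext => x /=; rewrite atanN.
Qed.

Lemma cvgy_affine (x0 v : R) : 0 < v -> (x - x0) / v @[x --> +oo] --> +oo.
Proof.
move=> v0; apply/cvgryPge => M; near=> x.
rewrite ler_pdivlMr// lerBrDr; near: x; apply: nbhs_pinfty_ge; exact: num_real.
Unshelve. all: by end_near. Qed.

Lemma cvgNy_affine (x0 v : R) : 0 < v -> (x - x0) / v @[x --> -oo] --> -oo.
Proof.
move=> v0; apply/cvgrNyPle => M; near=> x.
rewrite ler_pdivrMr// lerBlDr; near: x; apply: nbhs_ninfty_le; exact: num_real.
Unshelve. all: by end_near. Qed.

Lemma cvgy_atan_affine (x0 v : R) : 0 < v ->
  atan ((x - x0) / v) @[x --> +oo] --> pi / 2.
Proof. by move=> v0; exact: (cvg_comp _ _ (cvgy_affine x0 v0) (@cvgy_atan R)). Qed.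

Lemma cvgNy_atan_affine (x0 v : R) : 0 < v ->
  atan ((x - x0) / v) @[x --> -oo] --> - (pi / 2).
Proof. by move=> v0; exact: (cvg_comp _ _ (cvgNy_affine x0 v0) cvgNy_atan). Qed.

Lemma quad_gt0 (x0 v x : R) : 0 < v -> 0 < (x - x0) ^+ 2 + v ^+ 2.
Proof. by move=> v0; rewrite ltr_wpDl ?sqr_ge0 ?exprn_gt0. Qed.

Lemma der_cauchy_primitive (x0 v x : R) : 0 < v ->
  is_derive x 1 (fun y => v^-1 * atan ((y - x0) / v))
    ((x - x0) ^+ 2 + v ^+ 2)^-1.
Proof.
move=> v0; have D0 := lt0r_neq0 (quad_gt0 x0 x v0); have v1 := lt0r_neq0 v0.
by deriv; field; apply/andP.
Qed.

End CauchyKernel.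

(** * Hilbert transform from a partial fraction decomposition *)

Section HilbertOfRational.
Context {R : realType}.
Notation mu := (@lebesgue_measure R).
Implicit Types (f P p : R -> R) (x y v C e : R).

Lemma open_pv_domain x e : open (pv_domain x e).
Proof.
rewrite (_ : pv_domain x e =
  (fun y => `|x - y|) @^-1` [set z | e < z]); last by [].
apply: open_comp; last exact: open_gt.
move=> y _; apply: cvg_norm; apply: cvgB; [exact: cvg_cst|exact: cvg_id].
Qed.

Lemma measurable_pv_domain x e : measurable (pv_domain x e).
Proof. by apply: open_measurable; exact: open_pv_domain. Qed.

Lemma pv_domainE x e : 0 < e ->
  pv_domain x e = `]-oo, x - e[ `|` `]x + e, +oo[.
Proof.
move=> e0; apply/seteqP; split=> y; rewrite /pv_domain/= !in_itv/= andbT.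
- by rewrite ltr_normr => /orP[?|?]; [left|right]; lra.
- by rewrite ltr_normr; case=> ?; apply/orP; [left|right]; lra.
Qed.

Lemma cauchy_integrable (x0 v : R) : 0 < v ->
  mu.-integrable setT (fun y => (((y - x0) ^+ 2 + v ^+ 2)^-1)%:E).
Proof.
move=> v0.
have ck : continuous (fun y => ((y - x0) ^+ 2 + v ^+ 2)^-1).
  move=> y; have D0 := lt0r_neq0 (quad_gt0 x0 y v0).
  apply: (@der_continuous _ _ _ (- (2 * (y - x0)) / ((y - x0) ^+ 2 + v ^+ 2) ^+ 2)).
  by deriv; [exact: D0|field].
apply/integrableP; split.
  by apply/measurable_EFinP; exact: continuous_measurable_fun.
rewrite (_ : integral _ _ _ =
  \int[mu]_y (((y - x0) ^+ 2 + v ^+ 2)^-1)%:E)%E; last first.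
  apply: eq_integral => y _ /=; rewrite ger0_norm// invr_ge0.
  by rewrite ltW// quad_gt0.
rewrite (ge0_integral_line _ ck (fun y => der_cauchy_primitive x0 y v0)
   (cvgMl_tmp (cvgNy_atan_affine x0 v0)) (cvgMl_tmp (cvgy_atan_affine x0 v0))).
  by rewrite ltry.
by move=> y; rewrite invr_ge0 ltW// quad_gt0.
Qed.

Lemma near_pinfty_neq x : \forall y \near +oo, y != x.
Proof.
near=> y; rewrite gt_eqF//; near: y; apply: nbhs_pinfty_gt; exact: num_real.
Unshelve. all: by end_near. Qed.

Lemma near_ninfty_neq x : \forall y \near -oo, y != x.
Proof.
near=> y; rewrite lt_eqF//; near: y; apply: nbhs_ninfty_lt; exact: num_real.
Unshelve. all: by end_near. Qed.

Lemma cvgy_invB x : (y - x)^-1 @[y --> +oo] --> 0.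
Proof.
apply/gtr0_cvgV0.
  by near=> y; rewrite subr_gt0; near: y; apply: nbhs_pinfty_gt; exact: num_real.
by have := cvgy_affine x ltr01; under eq_fun do rewrite divr1.
Unshelve. all: by end_near. Qed.

Lemma cvgNy_invB x : (y - x)^-1 @[y --> -oo] --> 0.
Proof.
apply/ltr0_cvgV0.
  by near=> y; rewrite subr_lt0; near: y; apply: nbhs_ninfty_lt; exact: num_real.
by have := cvgNy_affine x ltr01; under eq_fun do rewrite divr1.
Unshelve. all: by end_near. Qed.

(** In the variable [t = 1 / (y - x)] the quotient of the two logarithms'
    arguments is the polynomial [1 + 2 (x - x0) t + ((x - x0)^2 + v^2) t^2], which
    equals [1] at [t = 0]; this treats both infinities at once. *)
Lemma cvg_log_ratio (F : set_system R) (FF : Filter F) (x0 v x : R) : 0 < v ->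
  (\forall y \near F, y != x) -> (y - x)^-1 @[y --> F] --> 0 ->
  ln ((y - x0) ^+ 2 + v ^+ 2) - ln ((x - y) ^+ 2) @[y --> F] --> 0.
Proof.
move=> v0 Fx Ft.
pose psi t := ln (1 + (2 * (x - x0) * t + ((x - x0) ^+ 2 + v ^+ 2) * t ^+ 2)).
have psi0 : psi 0 = 0 by rewrite /psi expr0n/= !mulr0 !addr0 ln1.
have cpsi : {for 0, continuous psi}.
  apply: (@der_continuous _ _ _ (2 * (x - x0))); rewrite /psi.
  deriv; first by rewrite expr0n/= !mulr0 !addr0 ltr01.
  by rewrite expr0n/= !mulr0 !addr0; field.
rewrite -psi0; apply: cvg_trans (continuous_cvg _ cpsi Ft).
apply: near_eq_cvg; near=> y.
have yx : y != x by near: y.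
have xy2 : 0 < (x - y) ^+ 2 by rewrite exprn_even_gt0//= subr_eq0 eq_sym.
have Q0 := quad_gt0 x0 y v0.
rewrite /= /psi -ln_div ?posrE//; congr ln.
by field; rewrite !subr_eq0 yx eq_sym yx.
Unshelve. all: by end_near. Qed.

(** The truncated integral is [be + (G (x - e) - G (x + e)) / pi], where
    [G y = al / 2 (ln D - ln (x - y)^2) + be atan ((y - x0) / v) + P y] is a
    primitive of the integrand off [x].  The values of [G] at the two infinities
    contribute [be], and the term [ln (x - y)^2] is even about [x], so the
    remaining difference only involves functions continuous at [x] and tends to
    [0] with [e]. *)
Lemma hilbert_rational f P p x (x0 : R) v C (al be : R) :
  0 < v -> continuous f ->
  (forall y, `|f y| <= C / ((y - x0) ^+ 2 + v ^+ 2)) ->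
  (forall y : R, is_derive y 1 P (p y)) ->
  P y @[y --> -oo] --> 0 -> P y @[y --> +oo] --> 0 ->
  (forall y, y != x -> f y / (x - y) =
     al * ((x - y)^-1 + (y - x0) / ((y - x0) ^+ 2 + v ^+ 2))
     + be * (v / ((y - x0) ^+ 2 + v ^+ 2)) + p y) ->
  has_hilbert f x /\ hilbert f x = be.
Proof.
move=> v0 cf fC dP PNy Py fE.
have v1 := lt0r_neq0 v0.
pose K y := ((y - x0) ^+ 2 + v ^+ 2)^-1.
have K0 y : 0 < K y by rewrite invr_gt0 quad_gt0.
have cK : continuous K.
  move=> y; have D0 := lt0r_neq0 (quad_gt0 x0 y v0); rewrite /K.
  apply: (@der_continuous _ _ _ (- (2 * (y - x0)) / ((y - x0) ^+ 2 + v ^+ 2) ^+ 2)).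
  by deriv; [exact: D0|field].
pose G y := al / 2 * (ln ((y - x0) ^+ 2 + v ^+ 2) - ln ((x - y) ^+ 2))
            + be * atan ((y - x0) / v) + P y.
have dG (y : R) : y != x -> is_derive y 1 G (f y / (x - y)).
  move=> yx; have dPy := dP y; rewrite /G fE//.
  have D0 := quad_gt0 x0 y v0; have D1 := lt0r_neq0 D0.
  have xy : 0 < (x - y) ^+ 2 by rewrite exprn_even_gt0//= subr_eq0 eq_sym.
  have xy1 : x - y != 0 by rewrite subr_eq0 eq_sym.
  deriv; [exact: D0|exact: xy|].
  by field; rewrite ?xy1 ?D1 ?v1 ?(addrC (v ^+ 2)) ?D1.
have G_lim (F : set_system R) (FF : Filter F) th :
    (\forall y \near F, y != x) -> (y - x)^-1 @[y --> F] --> 0 ->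
    atan ((y - x0) / v) @[y --> F] --> th -> P y @[y --> F] --> 0 ->
    G y @[y --> F] --> be * th.
  move=> Fx Ft Fth FP.
  rewrite (_ : be * th = al / 2 * 0 + be * th + 0); last by rewrite mulr0 add0r addr0.
  apply: cvgD FP; apply: cvgD; last exact: cvgMl_tmp.
  by apply: cvgMl_tmp; exact: cvg_log_ratio.
have Gy : G y @[y --> +oo] --> be * (pi / 2).
  apply: G_lim => //; [exact: near_pinfty_neq|exact: cvgy_invB|].
  exact: cvgy_atan_affine.
have GNy : G y @[y --> -oo] --> be * - (pi / 2).
  apply: G_lim => //; [exact: near_ninfty_neq|exact: cvgNy_invB|].
  exact: cvgNy_atan_affine.
pose h y := f y / (x - y).
have ch (y : R) : y != x -> {for y, continuous h}.
  move=> yx; apply: cvgM; first exact: cf.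
  apply: cvgV; first by rewrite subr_eq0 eq_sym.
  by apply: cvgB; [exact: cvg_cst|exact: cvg_id].
have hK e y : 0 < e -> e <= `|x - y| -> `|h y| <= C / e * K y.
  move=> e0 exy; rewrite /h normrM normfV.
  have := fC y; rewrite -/(K y) => fCy.
  have C0 : 0 <= C by rewrite -(pmulr_lge0 _ (K0 y)) (le_trans _ fCy).
  rewrite mulrAC; apply: ler_pM => //.
  by rewrite lef_pV2 ?posrE// (lt_le_trans e0).
have dK e (y : R) : is_derive y 1
    (fun y => C / e * (v^-1 * atan ((y - x0) / v))) (C / e * K y).
  have hd := der_cauchy_primitive x0 y v0.
  by apply: (der_eq (derM (der_cst (C / e) y) hd)); rewrite mul0r add0r.
have cKe e : continuous (fun y => C / e * K y).
  by move=> y; apply: cvgMl_tmp; exact: cK.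
have ih e : 0 < e -> mu.-integrable (pv_domain x e) (EFin \o h).
  move=> e0; have iK : mu.-integrable (pv_domain x e) (fun y => (C / e * K y)%:E).
    apply: (@integrableS _ _ R mu setT) => //; first exact: measurable_pv_domain.
    have := cauchy_integrable x0 v0; move/(integrableZl measurableT (C / e)).
    by apply: eq_integrable => //.
  apply: le_integrable iK => //.
  - exact: measurable_pv_domain.
  - apply/measurable_EFinP; apply: open_continuous_measurable_fun.
      exact: open_pv_domain.
    move=> y; rewrite inE /pv_domain/= => exy; apply: ch.
    by apply: contraTneq exy => ->; rewrite subrr normr0 -leNgt ltW.
  - move=> y; rewrite /pv_domain/= => exy; rewrite lee_fin.
    rewrite (le_trans (hK e y e0 (ltW exy)))// ler_norm //.
have truncE e : 0 < e ->
    hilbert_trunc f x e = be + pi^-1 * (G (x - e) - G (x + e)).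
  move=> e0; rewrite /hilbert_trunc -/h.
  have ihU := ih e e0; rewrite (pv_domainE _ e0) in ihU *.
  have il : mu.-integrable `]-oo, x - e[ (EFin \o h).
    by apply: (integrableS _ _ (@subsetUl _ _ _) ihU) => //; exact: measurableU.
  have ir : mu.-integrable `]x + e, +oo[ (EFin \o h).
    by apply: (integrableS _ _ (@subsetUr _ _ _) ihU) => //; exact: measurableU.
  rewrite Rintegral_setU//; last first.
    by apply/disj_setPS => y []; rewrite /= !in_itv/= andbT; lra.
  rewrite Rintegral_itv_bndo_bndc// Rintegral_itv_obnd_cbnd//.
  have xl y : y <= x - e -> y != x by move=> ?; apply/eqP; lra.
  have xr y : x + e <= y -> y != x by move=> ?; apply/eqP; lra.
  have nl y : y <= x - e -> e <= `|x - y| by move=> ?; rewrite ger0_norm; lra.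
  have nr y : x + e <= y -> e <= `|x - y| by move=> ?; rewrite ler0_norm; lra.
  rewrite (@Rintegral_left_ray _ h _ G _ _ _ _
    (fun y ye => hK e y e0 (nl y ye)) (fun y ye => dG y (xl y ye)) (fun y _ => dK e y)
    (fun y ye => ch y (xl y ye)) (fun y _ => cKe e y) GNy
    (cvgMl_tmp (cvgMl_tmp (cvgNy_atan_affine x0 v0)))).
  rewrite (@Rintegral_right_ray _ h _ G _ _ _ _
    (fun y ye => hK e y e0 (nr y ye)) (fun y ye => dG y (xr y ye)) (fun y _ => dK e y)
    (fun y ye => ch y (xr y ye)) (fun y _ => cKe e y) Gy
    (cvgMl_tmp (cvgMl_tmp (cvgy_atan_affine x0 v0)))).
  by have := lt0r_neq0 (pi_gt0 R); move: (@pi R) => q q0; field.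
(* [G] without its singular term, which cancels in [G (x - e) - G (x + e)]. *)
pose H y := al / 2 * ln ((y - x0) ^+ 2 + v ^+ 2) + be * atan ((y - x0) / v) + P y.
have cH : {for x, continuous H}.
  have dPx := dP x; have D0 := quad_gt0 x0 x v0.
  have [] : {D | is_derive x 1 H D}; last by move=> D; exact: der_continuous.
  by eexists; rewrite /H; deriv_rules; exact: D0.
have GH r : G (x - r) - G (x + r) = H (x - r) - H (x + r).
  rewrite /G /H (_ : x - (x - r) = r); last by ring.
  rewrite (_ : x - (x + r) = - r); last by ring.
  by rewrite sqrrN; ring.
have lim : hilbert_trunc f x e @[e --> 0^'+] --> be.
  have HH : be + pi^-1 * (H (x - e) - H (x + e)) @[e --> 0^'+] --> be.
    apply: cvg_at_right_filter.
    have cHl : H (x - e) @[e --> 0] --> H x.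
      apply: (continuous_cvg _ cH); rewrite -[X in _ --> X](subr0 x).
      by apply: cvgB; [exact: cvg_cst|exact: cvg_id].
    have cHr : H (x + e) @[e --> 0] --> H x.
      apply: (continuous_cvg _ cH); rewrite -[X in _ --> X](addr0 x).
      by apply: cvgD; [exact: cvg_cst|exact: cvg_id].
    have := cvgD (cvg_cst be) (cvgMl_tmp (a := pi^-1) (cvgB cHl cHr)).
    by rewrite subrr mulr0 addr0; apply.
  apply: cvg_trans HH; apply: near_eq_cvg; near=> e.
  by rewrite truncE// GH.
split; last exact: cvg_lim.
by split; [exact: ih|apply/cvg_ex; exists be].
Unshelve. all: by end_near. Qed.

End HilbertOfRational.

(** * The pole profiles and their Hilbert transforms *)

Section Profile.
Context {R : realType}.
Implicit Types (v w x y : R).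

Lemma quad_eq0 (z v : R) : z ^+ 2 + v ^+ 2 = 0 -> z = 0 /\ v = 0.
Proof.
move=> /eqP; rewrite paddr_eq0 ?sqr_ge0// !sqrf_eq0.
by case/andP => /eqP -> /eqP ->.
Qed.

(** The inverse of [0] being [0], both sides also vanish when [x = x0] and
    [v = 0]; this is thus an identity between functions of [v] and [w], and it
    can be differentiated along a trajectory. *)
Lemma omega_cplxE (x0 v w x : R) : omega_cplx x0 v w x =
  (- (4 * w * v) * ((x - x0) / ((x - x0) ^+ 2 + v ^+ 2) ^+ 2))%:C%C.
Proof.
rewrite /omega_cplx; set z := x - x0.
have [/quad_eq0[-> ->]|D0] := eqVneq (z ^+ 2 + v ^+ 2) 0.
  by rewrite !mulr0 subr0 addr0 subrr !mulr0 mul0r oppr0 mul0r.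
apply/eqP; rewrite eq_complex /=.
have D4 : (z * z - v * v) ^+ 2 + (z * v + v * z) ^+ 2 != 0.
  by rewrite (_ : _ + _ = (z ^+ 2 + v ^+ 2) ^+ 2) ?expf_neq0//; ring.
by apply/andP; split; apply/eqP; field; rewrite ?D0 ?D4.
Qed.

Lemma u_cplxE (x0 v w x : R) : u_cplx x0 v w x =
  (2 * w * ((x - x0) / ((x - x0) ^+ 2 + v ^+ 2)))%:C%C.
Proof.
rewrite /u_cplx; set z := x - x0.
have [/quad_eq0[-> ->]|D0] := eqVneq (z ^+ 2 + v ^+ 2) 0.
  by rewrite !mulr0 subr0 addr0 invr0 addr0 mulr0 mul0r mulr0.
apply/eqP; rewrite eq_complex /=.
by apply/andP; split; apply/eqP; field.
Qed.

Lemma omega_profE (x0 v w x : R) : omega_prof x0 v w x =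
  - (4 * w * v) * ((x - x0) / ((x - x0) ^+ 2 + v ^+ 2) ^+ 2).
Proof. by rewrite /omega_prof omega_cplxE. Qed.

Lemma u_profE (x0 v w x : R) : u_prof x0 v w x =
  2 * w * ((x - x0) / ((x - x0) ^+ 2 + v ^+ 2)).
Proof. by rewrite /u_prof u_cplxE. Qed.

Lemma der_dipole (x0 v c y : R) : 0 < v ->
  is_derive y 1 (fun y => c * ((y - x0) / ((y - x0) ^+ 2 + v ^+ 2) ^+ 2))
    (c * ((v ^+ 2 - 3 * (y - x0) ^+ 2) / ((y - x0) ^+ 2 + v ^+ 2) ^+ 3)).
Proof.
move=> v0; have D0 := lt0r_neq0 (quad_gt0 x0 y v0).
by deriv; [rewrite expf_neq0|field].
Qed.

Lemma der_quadrupole (x0 v c y : R) : 0 < v ->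
  is_derive y 1 (fun y => c * ((v ^+ 2 - 3 * (y - x0) ^+ 2)
                               / ((y - x0) ^+ 2 + v ^+ 2) ^+ 3))
    (c * (12 * (y - x0) * ((y - x0) ^+ 2 - v ^+ 2)
          / ((y - x0) ^+ 2 + v ^+ 2) ^+ 4)).
Proof.
move=> v0; have D0 := lt0r_neq0 (quad_gt0 x0 y v0).
by deriv; [rewrite expf_neq0|field].
Qed.

(** With [t = 1 / (y - x0)] these are [t^2 / (1 + v^2 t^2)] and
    [t / (1 + v^2 t^2)]. *)
Lemma cvg_quadratic_decay (F : set_system R) {FF : Filter F} (x0 v : R) :
  0 < v -> (\forall y \near F, y != x0) -> (y - x0)^-1 @[y --> F] --> 0 ->
  ((y - x0) ^+ 2 + v ^+ 2)^-1 @[y --> F] --> 0 /\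
  (y - x0) / ((y - x0) ^+ 2 + v ^+ 2) @[y --> F] --> 0.
Proof.
move=> v0 Fx Ft.
have psiP k n : (0 < n)%N -> {for 0, continuous (fun t : R => t ^+ n * (1 + k * t ^+ 2)^-1)}.
  move=> n0; apply: cvgM; first exact: exprn_continuous.
  apply: cvgV; first by rewrite expr0n mulr0 addr0 oner_neq0.
  apply: cvgD; first exact: cvg_cst.
  by apply: cvgMl_tmp; exact: exprn_continuous.
have psiF k n : (0 < n)%N ->
    (y - x0)^-1 ^+ n * (1 + k * (y - x0)^-1 ^+ 2)^-1 @[y --> F] --> 0.
  move=> n0; have := continuous_cvg FF (psiP k n n0) Ft.
  by rewrite expr0n eqn0Ngt n0 mul0r; apply.
split.
- apply: cvg_trans (psiF (v ^+ 2) 2 _) => //; apply: near_eq_cvg; near=> y.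
  have yx : y - x0 != 0 by rewrite subr_eq0; near: y.
  have D0 := lt0r_neq0 (quad_gt0 x0 y v0).
  by field; rewrite D0 yx.
- apply: cvg_trans (psiF (v ^+ 2) 1 _) => //; apply: near_eq_cvg; near=> y.
  have yx : y - x0 != 0 by rewrite subr_eq0; near: y.
  have D0 := lt0r_neq0 (quad_gt0 x0 y v0).
  by field; rewrite D0 yx.
Unshelve. all: by end_near. Qed.

Lemma der_inv_quad (x0 v y : R) : 0 < v ->
  is_derive y 1 (fun y => ((y - x0) ^+ 2 + v ^+ 2)^-1)
    (- (2 * (y - x0)) / ((y - x0) ^+ 2 + v ^+ 2) ^+ 2).
Proof.
move=> v0; have D0 := lt0r_neq0 (quad_gt0 x0 y v0).
by deriv; [exact: D0|field].
Qed.

Lemma der_lin_quad (x0 v y : R) : 0 < v ->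
  is_derive y 1 (fun y => (y - x0) / ((y - x0) ^+ 2 + v ^+ 2))
    ((v ^+ 2 - (y - x0) ^+ 2) / ((y - x0) ^+ 2 + v ^+ 2) ^+ 2).
Proof.
move=> v0; have D0 := lt0r_neq0 (quad_gt0 x0 y v0).
by deriv; [exact: D0|field].
Qed.

(** Here the rational part of the primitive is
    [k1 / D + k2 z / D + k3 z / D^2 + k4 (z / D)^2], with [z = y - x0]; this space
    contains all the rational primitives met below. *)
Lemma hilbert_quadratic_denominator (f : R -> R) (x0 v C al be k1 k2 k3 k4 x : R) :
  let D y := (y - x0) ^+ 2 + v ^+ 2 in
  let dK y := - (2 * (y - x0)) / D y ^+ 2 in
  let dq y := (v ^+ 2 - (y - x0) ^+ 2) / D y ^+ 2 in
  0 < v -> continuous f -> (forall y, `|f y| <= C / D y) ->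
  (forall y, y != x -> f y / (x - y) =
     al * ((x - y)^-1 + (y - x0) / D y) + be * (v / D y)
     + (k1 * dK y + k2 * dq y + k3 * (dq y / D y + (y - x0) / D y * dK y)
        + k4 * (2 * ((y - x0) / D y) * dq y))) ->
  has_hilbert f x /\ hilbert f x = be.
Proof.
move=> D dK dq v0 cf fC fE.
pose P y := k1 * (D y)^-1 + k2 * ((y - x0) / D y)
  + k3 * ((y - x0) / D y * (D y)^-1) + k4 * ((y - x0) / D y) ^+ 2.
have dP (y : R) : is_derive y 1 P (k1 * dK y + k2 * dq y
    + k3 * (dq y / D y + (y - x0) / D y * dK y)
    + k4 * (2 * ((y - x0) / D y) * dq y)).
  have hK := der_inv_quad x0 y v0; have hq := der_lin_quad x0 y v0.
  have h := derD (derD (derD (derM (der_cst k1 y) hK) (derM (der_cst k2 y) hq))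
    (derM (der_cst k3 y) (derM hq hK))) (derM (der_cst k4 y) (derX 2 hq)).
  by apply: (der_eq h); rewrite /dK /dq /D /=; ring.
have Plim (F : set_system R) (FF : Filter F) : (\forall y \near F, y != x0) ->
    (y - x0)^-1 @[y --> F] --> 0 -> P y @[y --> F] --> 0.
  move=> Fx Ft; have [hK hq] := cvg_quadratic_decay v0 Fx Ft.
  have := cvgD (cvgD (cvgD (cvgMl_tmp (a := k1) hK) (cvgMl_tmp (a := k2) hq))
    (cvgMl_tmp (a := k3) (cvgM hq hK))) (cvgMl_tmp (a := k4) (cvgM hq hq)).
  by rewrite !mulr0 !addr0; apply.
apply: (hilbert_rational v0 cf fC dP _ _ fE).
- exact: (Plim _ _ (near_ninfty_neq x0) (cvgNy_invB x0)).
- exact: (Plim _ _ (near_pinfty_neq x0) (cvgy_invB x0)).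
Qed.

(** With [a = x - x0] and [E = a^2 + v^2], the decomposition follows from
    [1 / ((a - z) D) = (1 / (a - z) + (z + a) / D) / E] used twice. *)
Lemma hilbert_dipole (x0 v c x : R) : 0 < v ->
  let f y := c * ((y - x0) / ((y - x0) ^+ 2 + v ^+ 2) ^+ 2) in
  has_hilbert f x /\
  hilbert f x = c * (((x - x0) ^+ 2 - v ^+ 2)
                     / (2 * v * ((x - x0) ^+ 2 + v ^+ 2) ^+ 2)).
Proof.
move=> v0 f; have v1 := lt0r_neq0 v0; have E0 := lt0r_neq0 (quad_gt0 x0 x v0).
pose E := (x - x0) ^+ 2 + v ^+ 2.
apply: (@hilbert_quadratic_denominator _ x0 v (`|c| / (2 * v)) (f x) _
  (- (c * (x - x0)) / (2 * E)) (- c / (2 * E)) 0 0) => //.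
- by move=> y; apply: der_continuous (der_dipole x0 c y v0).
- move=> y; have D0 := quad_gt0 x0 y v0.
  have h : `|y - x0| <= ((y - x0) ^+ 2 + v ^+ 2) / (2 * v).
    rewrite ler_pdivlMr ?mulr_gt0//.
    have := sqr_ge0 (`|y - x0| - v); rewrite sqrrB real_normK ?num_real; lra.
  rewrite /f normrM normrM normfV normrX (gtr0_norm D0) -!mulrA ler_wpM2l//.
  rewrite ler_pdivrMr ?exprn_gt0// (le_trans h)// le_eqVlt; apply/orP; left.
  by apply/eqP; field; rewrite lt0r_neq0.
- move=> y yx; have D0 := lt0r_neq0 (quad_gt0 x0 y v0).
  have xy1 : x - y != 0 by rewrite subr_eq0 eq_sym.
  by rewrite /f /E; field; rewrite D0 E0 v1.
Qed.

(** The coefficients are those obtained by applying [d/da + d/dz] to the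
    decomposition of the dipole, as translations commute with the kernel
    [1 / (a - z)]. *)
Lemma hilbert_quadrupole (x0 v c x : R) : 0 < v ->
  let f y := c * ((v ^+ 2 - 3 * (y - x0) ^+ 2)
                  / ((y - x0) ^+ 2 + v ^+ 2) ^+ 3) in
  has_hilbert f x /\
  hilbert f x = c * ((x - x0) * (3 * v ^+ 2 - (x - x0) ^+ 2)
                     / (v * ((x - x0) ^+ 2 + v ^+ 2) ^+ 3)).
Proof.
move=> v0 f; have v1 := lt0r_neq0 v0; have E0 := lt0r_neq0 (quad_gt0 x0 x v0).
pose E := (x - x0) ^+ 2 + v ^+ 2.
apply: (@hilbert_quadratic_denominator _ x0 v (3 * `|c| / v ^+ 2) (f x) _
  (c * ((x - x0) ^+ 2 - 3 * v ^+ 2) / (2 * E ^+ 2)) (2 * c * (x - x0) / E ^+ 2)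
  (c * (x - x0) / E) (c / E)) => //.
- by move=> y; apply: der_continuous (der_quadrupole x0 c y v0).
- move=> y; have D0 := quad_gt0 x0 y v0.
  have Dv : v ^+ 2 <= (y - x0) ^+ 2 + v ^+ 2 by rewrite lerDr sqr_ge0.
  have vv : 0 < v ^+ 2 by rewrite exprn_gt0.
  have h : `|v ^+ 2 - 3 * (y - x0) ^+ 2| <= 3 * ((y - x0) ^+ 2 + v ^+ 2).
    by rewrite ler_norml; have := sqr_ge0 (y - x0); lra.
  rewrite /f normrM normrM normfV normrX (gtr0_norm D0).
  rewrite (_ : 3 * `|c| / v ^+ 2 / _ =
    `|c| * (3 / (v ^+ 2 * ((y - x0) ^+ 2 + v ^+ 2)))); last first.
    by field; rewrite v1 lt0r_neq0.
  rewrite ler_wpM2l// ler_pdivrMr ?exprn_gt0// (le_trans h)//.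
  rewrite (_ : 3 / _ * _ = 3 * ((y - x0) ^+ 2 + v ^+ 2)
    * (((y - x0) ^+ 2 + v ^+ 2) / v ^+ 2)); last first.
    by field; rewrite v1 lt0r_neq0.
  by rewrite ler_peMr ?ler_pdivlMr ?mul1r// mulr_ge0// ltW.
- move=> y yx; have D0 := lt0r_neq0 (quad_gt0 x0 y v0).
  have xy1 : x - y != 0 by rewrite subr_eq0 eq_sym.
  by rewrite /f /E; field; rewrite D0 E0 v1.
Qed.

End Profile.

(** * The exact solution *)

Section Solution.
Context {R : realType}.

Lemma omega_pole_real (x0 : R) (v w : R -> R) x t :
  (omega_pole x0 v w x t)%:C%C = omega_cplx x0 (v t) (w t) x.
Proof. by rewrite omega_cplxE /omega_pole omega_profE. Qed.

Lemma u_pole_real (x0 : R) (v w : R -> R) x t :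
  (u_pole x0 v w x t)%:C%C = u_cplx x0 (v t) (w t) x.
Proof. by rewrite u_cplxE /u_pole u_profE. Qed.

Lemma omega_pole_continuous (nu : R) (J : set R) (x0 : R) (v w : R -> R) :
  pole_flow nu J v w ->
  {within [set p : R * R | J p.2],
    continuous (fun p : R * R => omega_pole x0 v w p.1 p.2)}.
Proof.
move=> [vw0 cv cw _].
rewrite (_ : (fun p : R * R => _) = fun p => - (4 * w p.2 * v p.2) *
    ((p.1 - x0) / ((p.1 - x0) ^+ 2 + v p.2 ^+ 2) ^+ 2)); last first.
  by apply/funext => p; rewrite /omega_pole omega_profE.
apply/subspace_continuousP => p /= Jp.
have cJ (f : R -> R) : {within J, continuous f} ->
    f q.2 @[q --> within [set q : R * R | J q.2] (nbhs p)] --> f p.2.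
  move=> /subspace_continuousP /(_ _ Jp) cf.
  apply: cvg_comp cf.
  move=> B /= wB; rewrite /fmap/= /within/=.
  have c2 : q.2 @[q --> nbhs p] --> p.2 by exact: cvg_snd.
  exact: (c2 _ wB).
have cx : (q.1 - x0) @[q --> within [set q : R * R | J q.2] (nbhs p)] --> p.1 - x0.
  apply: cvgB; last exact: cvg_cst.
  by apply: cvg_within_filter; exact: cvg_fst.
have [v0 _] := vw0 _ Jp.
apply: cvgM.
  apply: cvgN; apply: cvgM; last exact: cJ.
  by apply: cvgM; [exact: cvg_cst|exact: cJ].
apply: cvgM; first exact: cx.
apply: cvgV; first by rewrite expf_neq0// lt0r_neq0// quad_gt0.
have cD : ((q.1 - x0) ^+ 2 + v q.2 ^+ 2) @[q --> within [set q : R * R | J q.2] (nbhs p)]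
   --> (p.1 - x0) ^+ 2 + v p.2 ^+ 2.
  apply: cvgD; first by apply: cvgM; exact: cx.
  by apply: cvgM; exact: cJ.
by apply: cvgM; exact: cD.
Qed.

(** After multiplication by [D^3 / (- 4 z)], the equation is the identity
    between [(w v)' D - 4 w v^2 v'] and [w^2 v + nu w (z^2 - 3 v^2)], which the two
    differential equations for [v] and [w] make true for every [z]. *)
Lemma pole_solution (nu : R) (J : set R) (x0 : R) (v w : R -> R) :
  pole_flow nu J v w ->
  is_solution nu J (omega_pole x0 v w) (u_pole x0 v w).
Proof.
move=> vw; split; first exact: omega_pole_continuous vw.
all: case: vw => vw0 _ _ dvw.
all: have omE t : omega_pole x0 v w ^~ t = fun x : R => - (4 * w t * v t) *
    ((x - x0) / ((x - x0) ^+ 2 + v t ^+ 2) ^+ 2)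
  by apply/funext => x; rewrite /omega_pole omega_profE.
all: have uE t : u_pole x0 v w ^~ t = fun x : R => 2 * w t *
    ((x - x0) / ((x - x0) ^+ 2 + v t ^+ 2))
  by apply/funext => x; rewrite /u_pole u_profE.
- move=> x t Jt; have [v0 w0] := vw0 t Jt.
  have D0 := lt0r_neq0 (quad_gt0 x0 x v0); have v1 := lt0r_neq0 v0.
  have [hh hE] := hilbert_dipole x0 (- (4 * w t * v t)) x v0.
  rewrite omE uE; split; [|exact: hh|].
    exact: (@ex_derive _ _ _ _ _ _ _ (der_dipole x0 _ x v0)).
  rewrite hE; have h := der_lin_quad x0 x v0.
  apply: (der_eq (derM (der_cst (2 * w t) x) h)).
  by field; rewrite D0 v1.
- move=> x t Jt; have [v0 w0] := vw0 t (interior_subset Jt).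
  have D0 := lt0r_neq0 (quad_gt0 x0 x v0); have v1 := lt0r_neq0 v0.
  have [dv dw] := dvw t Jt.
  set c := - (4 * w t * v t).
  have dE : derive1 (omega_pole x0 v w ^~ t) = fun x : R => c *
      ((v t ^+ 2 - 3 * (x - x0) ^+ 2) / ((x - x0) ^+ 2 + v t ^+ 2) ^+ 3).
    apply/funext => y; rewrite derive1E omE.
    exact: (@derive_val _ _ _ _ _ _ _ (der_dipole x0 c y v0)).
  have [h1 h1E] := hilbert_dipole x0 c x v0.
  have [h2 h2E] := hilbert_quadrupole x0 c x v0.
  rewrite /Lambda dE omE h2E h1E; split; first exact: h2.
  have -> : omega_pole x0 v w x = fun s => - (4 * w s * v s) *
     ((x - x0) / ((x - x0) ^+ 2 + v s ^+ 2) ^+ 2).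
    by apply/funext => s; rewrite /omega_pole omega_profE.
  rewrite /u_pole u_profE /c.
  deriv; first by rewrite expf_neq0.
  by field; rewrite D0 v1.
Qed.

End Solution.

(** * Norms *)

Section Norms.
Context {R : realType}.
Notation mu := (@lebesgue_measure R).

(** If the essential supremum were smaller than the maximum, [f] would exceed it
    on a nonempty open interval, which has positive measure. *)
Lemma norm_Loo_max (f : R -> R) (xm : R) :
  continuous f -> (forall x, `|f x| <= `|f xm|) -> norm_Loo f = `|f xm|%:E.
Proof.
move=> cf fm; rewrite /norm_Loo unlock /= -set_itvNyy lebesgue_measure_itv/= ltry.
apply/eqP; rewrite eq_le; apply/andP; split.
  by apply/ess_supP; apply: nearW => x /=; rewrite lee_fin.
rewrite leNgt; apply/negP => lt.
have [r r0 rf] : exists2 r : R, 0 < r & forall x, `|x - xm| < r ->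
    (ess_sup mu (abse \o (EFin \o f)) < `|f x|%:E)%E.
  have : \forall x \near xm, (ess_sup mu (abse \o (EFin \o f)) < `|f x|%:E)%E.
    case: (ess_sup mu _) lt => [s|//|_]; last by apply: (@filterE _ _ (nbhs_filter xm)) => x; rewrite ltNye.
    rewrite lte_fin => sf; have cn : `|f x| @[x --> xm] --> `|f xm|.
      by apply: cvg_norm; exact: cf.
    by apply: filterS (cvgr_gt _ cn _ sf) => x; rewrite lte_fin.
  move=> /nbhs_ballP[r /= r0 rf]; exists r => // x xr.
  by apply: rf; rewrite /ball /= distrC.
have [N [mN N0 subN]] := ess_sup_ge mu (abse \o (EFin \o f)).
have : (mu `](xm - r)%R, (xm + r)%R[ <= mu N)%E.
  apply: le_measure; rewrite ?inE//.
  move=> x /=; rewrite in_itv/= => /andP[h1 h2]; apply: subN => /=.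
  have xr : `|x - xm| < r by rewrite ltr_norml; lra.
  by apply/negP; rewrite -ltNge; exact: rf.
rewrite N0 lebesgue_measure_itv/= lte_fin ifT; last by lra.
by rewrite -EFinB lee_fin; lra.
Qed.

Lemma norm_L2_sqrt (f : R -> R) (I : R) :
  (\int[mu]_x (f x ^+ 2)%:E = I%:E)%E -> norm_L2 f = (Num.sqrt I)%:E.
Proof.
move=> fI; rewrite /norm_L2 unlock /=.
have -> : (\int[mu]_x `|(f x)%:E| `^ 2 = I%:E)%E.
  rewrite -fI; apply: eq_integral => x _ /=.
  by rewrite powR_mulrn// real_normK ?num_real.
have I0 : 0 <= I.
  rewrite -lee_fin -fI; apply: integral_ge0 => x _.
  by rewrite lee_fin sqr_ge0.
by rewrite poweR_EFin powR12_sqrt.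
Qed.

(** With [s = sqrt 3] and [r = |z|], the extremum at [r = v / s] comes
    from [9 (r^2 + v^2)^2 - 16 s r v^3
          = (s r - v)^2 (s^2 r^2 + 2 s r v + 9 v^2)]. *)
Lemma dipole_bound (z v : R) : 0 < v ->
  `|z / (z ^+ 2 + v ^+ 2) ^+ 2| <= 3 * Num.sqrt 3 / (16 * v ^+ 3).
Proof.
move=> v0; have D0 : 0 < z ^+ 2 + v ^+ 2 by rewrite ltr_wpDl ?sqr_ge0 ?exprn_gt0.
rewrite normrM normfV normrX (gtr0_norm D0) ler_pdivrMr ?exprn_gt0//.
rewrite mulrAC ler_pdivlMr ?mulr_gt0 ?exprn_gt0//.
rewrite -(real_normK (num_real z)); set r := `|z|.
have r0 : 0 <= r by exact: normr_ge0.
set s := Num.sqrt 3; have s0 : 0 < s by rewrite sqrtr_gt0.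
have s2 : s ^+ 2 = 3 by rewrite sqr_sqrtr.
rewrite -(ler_pM2l s0).
rewrite (_ : s * (3 * s * _) = 9 * (r ^+ 2 + v ^+ 2) ^+ 2); last first.
  rewrite [LHS](_ : _ = s ^+ 2 * (3 * (r ^+ 2 + v ^+ 2) ^+ 2)); last by ring.
  by rewrite s2; ring.
rewrite -subr_ge0 (_ : _ - _ = (s * r - v) ^+ 2
    * (s ^+ 2 * r ^+ 2 + 2 * s * r * v + 9 * v ^+ 2)); last first.
  rewrite [RHS](_ : _ = (s ^+ 2) ^+ 2 * r ^+ 4 + 6 * s ^+ 2 * r ^+ 2 * v ^+ 2
    - 16 * s * r * v ^+ 3 + 9 * v ^+ 4); last by ring.
  by rewrite s2; ring.
have v0' := ltW v0; have s0' := ltW s0.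
by rewrite mulr_ge0 ?sqr_ge0 ?addr_ge0 ?mulr_ge0 ?sqr_ge0.
Qed.

Lemma norm_Loo_omega (x0 v w : R) : 0 < v ->
  norm_Loo (omega_prof x0 v w) = (3 * Num.sqrt 3 / 4 * (`|w / v| / v))%:E.
Proof.
move=> v0; have v1 := lt0r_neq0 v0.
set s := Num.sqrt 3; have s0 : 0 < s by rewrite sqrtr_gt0.
have s1 := lt0r_neq0 s0; have s2 : s ^+ 2 = 3 by rewrite sqr_sqrtr.
have cE : `|- (4 * w * v)| = 4 * v * `|w|.
  by rewrite normrN !normrM (gtr0_norm v0) ger0_norm//; ring.
have fm : `|omega_prof x0 v w (x0 + v / s)| = 3 * s / 4 * (`|w / v| / v).
  rewrite omega_profE (_ : x0 + v / s - x0 = v / s); last by ring.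
  rewrite normrM cE (normrM w) normfV (gtr0_norm v0).
  rewrite ger0_norm; last first.
    by rewrite divr_ge0 ?exprn_ge0 ?addr_ge0 ?sqr_ge0// divr_ge0// ltW.
  rewrite exprMn exprVn s2 (_ : s^-1 = s / 3); last first.
    by rewrite -s2; field.
  have D4 : v ^+ 2 + v ^+ 2 * 3 != 0 by rewrite lt0r_neq0 ?addr_gt0 ?mulr_gt0 ?exprn_gt0.
  by field; rewrite v1 D4.
rewrite -fm; apply: norm_Loo_max.
- rewrite (_ : omega_prof x0 v w = fun x => - (4 * w * v)
    * ((x - x0) / ((x - x0) ^+ 2 + v ^+ 2) ^+ 2)).
    by move=> x; apply: der_continuous (der_dipole x0 _ x v0).
  by apply/funext => x; rewrite omega_profE.
- move=> x; rewrite fm omega_profE normrM cE (normrM w) normfV (gtr0_norm v0).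
  apply: le_trans (ler_wpM2l _ (dipole_bound (x - x0) v0)) _.
    by rewrite mulr_ge0// mulr_ge0// ltW.
  by rewrite -/s le_eqVlt; apply/orP; left; apply/eqP; field.
Qed.

(** The primitive is found by lowering the powers of [D] with
    [(z / D^n)' = (1 - 2 n) / D^n + 2 n v^2 / D^(n+1)]. *)
Lemma integral_omega_sqr (x0 v w : R) : 0 < v ->
  (\int[mu]_x (omega_prof x0 v w x ^+ 2)%:E = (pi * w ^+ 2 / v ^+ 3)%:E)%E.
Proof.
move=> v0; have v1 := lt0r_neq0 v0.
pose K y := ((y - x0) ^+ 2 + v ^+ 2)^-1.
pose q y := (y - x0) / ((y - x0) ^+ 2 + v ^+ 2).
pose A := 16 * w ^+ 2 * v ^+ 2.
pose F y := A * (- 6^-1 * (q y * (K y * K y)) + (24 * v ^+ 2)^-1 * (q y * K y)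
   + (16 * v ^+ 4)^-1 * q y + (16 * v ^+ 4)^-1 * (v^-1 * atan ((y - x0) / v))).
have dF (y : R) : is_derive y 1 F (omega_prof x0 v w y ^+ 2).
  have D0 := lt0r_neq0 (quad_gt0 x0 y v0).
  have hK := der_inv_quad x0 y v0; have hq := der_lin_quad x0 y v0.
  have ha := der_cauchy_primitive x0 y v0.
  have h := derM (der_cst A y) (derD (derD (derD
     (derM (der_cst (- 6^-1) y) (derM hq (derM hK hK)))
     (derM (der_cst (24 * v ^+ 2)^-1 y) (derM hq hK)))
     (derM (der_cst (16 * v ^+ 4)^-1 y) hq))
     (derM (der_cst (16 * v ^+ 4)^-1 y) ha)).
  by apply: (der_eq h); rewrite omega_profE /A; field; rewrite D0 v1.
have Flim (G : set_system R) (GG : Filter G) th : (\forall y \near G, y != x0) ->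
    (y - x0)^-1 @[y --> G] --> 0 -> atan ((y - x0) / v) @[y --> G] --> th ->
    F y @[y --> G] --> A * ((16 * v ^+ 4)^-1 * (v^-1 * th)).
  move=> Gx Gt Gth; have [hK hq] := cvg_quadratic_decay v0 Gx Gt.
  have := cvgMl_tmp (a := A) (cvgD (cvgD (cvgD
    (cvgMl_tmp (a := - 6^-1) (cvgM hq (cvgM hK hK)))
    (cvgMl_tmp (a := (24 * v ^+ 2)^-1) (cvgM hq hK)))
    (cvgMl_tmp (a := (16 * v ^+ 4)^-1) hq))
    (cvgMl_tmp (a := (16 * v ^+ 4)^-1) (cvgMl_tmp (a := v^-1) Gth))).
  by rewrite !(mulr0, add0r); apply.
rewrite (ge0_integral_line _ _ dF
  (Flim _ _ _ (near_ninfty_neq x0) (cvgNy_invB x0) (cvgNy_atan_affine x0 v0))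
  (Flim _ _ _ (near_pinfty_neq x0) (cvgy_invB x0) (cvgy_atan_affine x0 v0))).
- by congr EFin; rewrite /A; move: (@pi R) => p; field.
- by move=> x; rewrite sqr_ge0.
- move=> y; rewrite (_ : (fun x => _) = fun x => (- (4 * w * v)
    * ((x - x0) / ((x - x0) ^+ 2 + v ^+ 2) ^+ 2)) ^+ 2).
    exact: der_continuous (derX 2 (der_dipole x0 _ y v0)).
  by apply/funext => x; rewrite omega_profE.
Qed.

Lemma norm_L2_omega (x0 v w : R) : 0 < v ->
  norm_L2 (omega_prof x0 v w) = (Num.sqrt pi * (`|w / v| / Num.sqrt v))%:E.
Proof.
move=> v0; rewrite (norm_L2_sqrt (integral_omega_sqr x0 w v0)); congr EFin.
rewrite (_ : pi * w ^+ 2 / v ^+ 3 = pi * ((w / v) ^+ 2 / v)); last first.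
  by move: (@pi R) => p; field; rewrite lt0r_neq0.
rewrite sqrtrM ?pi_ge0// sqrtrM ?sqr_ge0// sqrtr_sqr sqrtrV//.
exact: ltW.
Qed.

End Norms.

(** * Analyticity in space *)

Section Analyticity.

Lemma sum_arith_geometric (F : comNzRingType) (q : F) n :
  (1 - q) ^+ 2 * (\sum_(0 <= k < n) k.+1%:R * q ^+ k) =
  1 - (n.+1%:R * q ^+ n - n%:R * q ^+ n.+1).
Proof.
elim: n => [|n IH]; first by rewrite big_nil mul0r mulr0 mul1r expr0 subr0 subrr.
rewrite big_nat_recr//= mulrDr IH -!natr1 !exprS; ring.
Qed.

(** [1 / (b + h)^2 = b^-2 / (1 - q)^2] with [q = - h / b], and the partial sums
    of [1 / (1 - q)^2] are explicit. *)
Lemma inv_square_taylor (F : fieldType) (b h : F) n : b != 0 -> b + h != 0 ->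
  ((b + h) ^+ 2)^-1 - \sum_(0 <= k < n) k.+1%:R * (- b^-1) ^+ k / b ^+ 2 * h ^+ k
  = ((b + h) ^+ 2)^-1 * (n.+1%:R * (- (h / b)) ^+ n - n%:R * (- (h / b)) ^+ n.+1).
Proof.
move=> b0 bh0; set q := - (h / b); set r := (X in _ = _ * X).
have bhE : b + h = b * (1 - q) by rewrite /q; field.
have q1 : 1 - q != 0 by apply: contraNneq bh0 => e; rewrite bhE e mulr0.
rewrite (_ : \sum_(0 <= k < n) _ = (b ^+ 2)^-1 * (\sum_(0 <= k < n) k.+1%:R * q ^+ k)).
  have -> : \sum_(0 <= k < n) k.+1%:R * q ^+ k = (1 - r) / (1 - q) ^+ 2.
    by rewrite -sum_arith_geometric mulrC mulKf// expf_neq0.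
  by rewrite bhE; field; rewrite b0 q1.
rewrite mulr_sumr; apply: eq_bigr => k _.
rewrite (_ : q = - b^-1 * h); last by rewrite /q mulNr mulrC.
by rewrite exprMn; move: (_ ^+ k) (h ^+ k) => u t; ring.
Qed.

Context {R : realType}.
Local Open Scope complex_scope.
Import Normc.

Lemma Re_le_normc (z : R[i]) : `|complex.Re z| <= normc z.
Proof. by have := normc_ge_Re z; rewrite lecR. Qed.

Lemma Im_le_normc (z : R[i]) : `|complex.Im z| <= normc z.
Proof.
case: z => a b /=; rewrite -sqrtr_sqr ler_wsqrtr// lerDr sqr_ge0 //.
Qed.

Lemma ReB (z t : R[i]) : complex.Re (z - t) = complex.Re z - complex.Re t.
Proof. by case: z t => a b [c d]. Qed.

Lemma Re_mulr (z : R[i]) (t : R) : complex.Re (z * t%:C) = complex.Re z * t.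
Proof. by case: z => a b /=; rewrite mulr0 subr0. Qed.

Lemma Re_sum (F : nat -> R[i]) n :
  complex.Re (\sum_(0 <= k < n) F k) = \sum_(0 <= k < n) complex.Re (F k).
Proof. by apply: (big_morph (@complex.Re R)) => // -[a b] [c d]. Qed.

Lemma normc_ge0 (z : R[i]) : 0 <= normc z.
Proof. by case: z => a b /=; exact: sqrtr_ge0. Qed.

Lemma normcX (z : R[i]) n : normc (z ^+ n) = normc z ^+ n.
Proof. by elim: n => [|n IH]; rewrite ?normc1// !exprS normcM IH. Qed.

Lemma normc_nat n : normc (n%:R : R[i]) = n%:R.
Proof. by rewrite normcMn normc1. Qed.

(** On the disc [4 |h| <= v <= |b|] one has [|q| <= 1 / 4], and the factor [n + 1]
    in the remainder is absorbed by [n + 1 <= 2^n]. *)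
Lemma taylor_remainder (b : R[i]) (v h : R) n : 0 < v -> v <= normc b ->
  `|h| <= v / 4 ->
  normc (((b + h%:C) ^+ 2)^-1
    - \sum_(0 <= k < n) k.+1%:R * (- b^-1) ^+ k / b ^+ 2 * h%:C ^+ k)
  <= normc ((b + h%:C) ^+ 2)^-1 * (2 * (2^-1) ^+ n).
Proof.
move=> v0 vb hv; have nb0 : 0 < normc b by rewrite (lt_le_trans v0).
have b0 : b != 0 by apply: contraTneq nb0 => ->; rewrite normc0 ltxx.
have nh : normc h%:C = `|h| by rewrite /= expr0n addr0 sqrtr_sqr.
have q4 : normc (- (h%:C / b)) <= 4^-1.
  rewrite normcN normcM normcV nh ler_pdivrMr// (le_trans hv)//.
  by rewrite mulrC ler_wpM2l// invr_ge0.
have bh0 : b + h%:C != 0.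
  apply/eqP => /eqP; rewrite addr_eq0 => /eqP bE.
  by move: vb; rewrite bE normcN nh; lra.
rewrite inv_square_taylor// normcM ler_wpM2l ?normc_ge0//.
apply: le_trans (le_normcD _ _) _; rewrite normcN !normcM !normc_nat !normcX.
set q := normc _ in q4 *; have q0 : 0 <= q by exact: normc_ge0.
have qn k : q ^+ k <= 4^-1 ^+ k by rewrite lerXn2r// nnegrE// invr_ge0.
have n2 : n.+1%:R <= 2 ^+ n :> R by rewrite -natrX ler_nat ltn_expl.
have n2' : n%:R <= 2 ^+ n :> R by rewrite -natrX ler_nat ltnW// ltn_expl.
have qS : q ^+ n.+1 <= 4^-1 ^+ n.
  rewrite exprS (le_trans _ (qn n))// ler_piMl ?exprn_ge0//.
  by rewrite (le_trans q4)// invf_le1// ler1n.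
have -> : 2 * 2^-1 ^+ n = 2 ^+ n * 4^-1 ^+ n + 2 ^+ n * 4^-1 ^+ n :> R.
  rewrite {1}(_ : 2^-1 = 2 * 4^-1); last by field.
  by rewrite exprMn; ring.
by rewrite lerD// ler_pM ?exprn_ge0.
Qed.

(** [omega] is the real part of a combination of [1 / (b + h)^2] and
    [1 / (b' + h)^2] with [h = y - x] real, and the real parts of the complex
    Taylor coefficients are real Taylor coefficients. *)
Lemma omega_real_analytic (x0 v w x : R) : 0 < v ->
  real_analytic_at (omega_prof x0 v w) x.
Proof.
move=> v0.
pose b := (x - x0)%:C - 'i * v%:C; pose b' := (x - x0)%:C + 'i * v%:C.
pose g (z : R[i]) k := k.+1%:R * (- z^-1) ^+ k / z ^+ 2.
exists (fun k => complex.Re ('i * w%:C * (g b k - g b' k))), (v / 4).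
split; first by rewrite divr_gt0.
move=> y; set h := y - x => hv.
have vb : v <= normc b.
  apply: le_trans (Im_le_normc _); rewrite /b /=.
  by rewrite (_ : _ - _ = - v) ?normrN ?ler_norm//; ring.
have vb' : v <= normc b'.
  apply: le_trans (Im_le_normc _); rewrite /b' /=.
  by rewrite (_ : _ + _ = v) ?ler_norm//; ring.
pose M := `|w| * (normc ((b + h%:C) ^+ 2)^-1 + normc ((b' + h%:C) ^+ 2)^-1) * 2.
have err n : `|series (fun k => complex.Re ('i * w%:C * (g b k - g b' k)) * h ^+ k) n
    - omega_prof x0 v w y| <= M * 2^-1 ^+ n.
  have -> : series (fun k => complex.Re ('i * w%:C * (g b k - g b' k)) * h ^+ k) n =
      complex.Re ('i * w%:C * (\sum_(0 <= k < n) g b k * h%:C ^+ k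
                               - \sum_(0 <= k < n) g b' k * h%:C ^+ k)).
    rewrite /series /= -sumrB mulr_sumr Re_sum; apply: eq_bigr => k _.
    rewrite -mulrBl mulrA -rmorphXn /=; exact/esym/Re_mulr.
  rewrite /omega_prof /omega_cplx.
  rewrite (_ : (y - x0)%:C - _ = b + h%:C); last first.
    by rewrite /b /h (_ : y - x0 = (x - x0) + (y - x)) ?rmorphD/=; ring.
  rewrite (_ : (y - x0)%:C + _ = b' + h%:C); last first.
    by rewrite /b' /h (_ : y - x0 = (x - x0) + (y - x)) ?rmorphD/=; ring.
  have hb := taylor_remainder n v0 vb (ltW hv).
  have hb' := taylor_remainder n v0 vb' (ltW hv).
  rewrite -ReB -mulrBr; apply: le_trans (Re_le_normc _) _.
  rewrite !normcM; have -> : normc 'i = 1 :> R.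
    by rewrite /= expr0n add0r expr1n sqrtr1.
  have -> : normc w%:C = `|w| by rewrite /= expr0n addr0 sqrtr_sqr.
  rewrite mul1r /M -!mulrA ler_wpM2l// mulrDl.
  apply: le_trans (lerD hb hb').
  rewrite -(normcN (_ - \sum_(0 <= k < n) _)) opprB.
  apply: le_trans (le_normcD _ _); rewrite le_eqVlt; apply/orP; left; apply/eqP.
  by congr normc; rewrite /g; ring.
apply/cvgrPdist_le => e e0; near=> n.
rewrite distrC (le_trans (err n))//.
have M0 : 0 <= M by rewrite mulr_ge0// mulr_ge0// addr_ge0 ?normc_ge0.
near: n.
have : M * 2^-1 ^+ n @[n --> \oo] --> M * 0.
  apply: cvgMl_tmp; apply: cvg_expr.
  by rewrite ger0_norm ?invr_ge0// invf_lt1// ltr1n.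
by rewrite mulr0 => /cvgr_le; apply.
Unshelve. all: by end_near. Qed.

End Analyticity.

(** * Increasing functions on an interval and their inverses *)

Section InverseFunction.
Context {R : realType}.
Implicit Types (f : R -> R) (a b x y c : R).

Lemma constant_on_segment f a b : a <= b -> {within `[a, b], continuous f} ->
  (forall x, a < x < b -> is_derive x 1 f 0) -> f b = f a.
Proof.
move=> ab cf df.
have hd x : x \in `]a, b[ -> is_derive x 1 f 0 by rewrite in_itv/=; exact: df.
have [_ _] := MVT_segment ab hd cf.
by rewrite mul0r => /eqP; rewrite subr_eq0 => /eqP.
Qed.

Lemma lt_of_pos_derivative f (df : R -> R) a b : a < b ->
  {within `[a, b], continuous f} ->
  (forall x, a < x < b -> is_derive x 1 f (df x)) ->
  (forall x, a < x < b -> 0 < df x) -> f a < f b.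
Proof.
move=> ab cf hdf pos.
have hd x : x \in `]a, b[ -> is_derive x 1 f (df x).
  by rewrite in_itv/=; exact: hdf.
have [x] := MVT ab hd cf.
by rewrite in_itv/= => xab; rewrite -subr_gt0 => ->; rewrite mulr_gt0 ?subr_gt0// pos.
Qed.

Lemma within_continuous_der f (df : R -> R) a b :
  (forall x, a <= x <= b -> is_derive x 1 f (df x)) ->
  {within `[a, b], continuous f}.
Proof.
move=> h; apply: continuous_in_subspaceT => x; rewrite inE/= in_itv/= => xab.
exact: der_continuous (h x xab).
Qed.

Lemma le_of_nonneg_derivative f (df : R -> R) a b : a <= b ->
  (forall x, a <= x <= b -> is_derive x 1 f (df x)) ->
  (forall x, a <= x <= b -> 0 <= df x) -> f a <= f b.
Proof.
move=> ab hdf pos; have cf := within_continuous_der hdf.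
have hd x : x \in `]a, b[ -> is_derive x 1 f (df x).
  by rewrite in_itv/= => /andP[/ltW ax /ltW xb]; apply: hdf; rewrite ax xb.
have [x] := MVT_segment ab hd cf.
by rewrite in_itv/= => xab; rewrite -subr_ge0 => ->; rewrite mulr_ge0 ?subr_ge0// pos.
Qed.

Variables (U : set R) (f th : R -> R).
Hypotheses (Uop : open U) (Uitv : is_interval U)
  (df : forall y, U y -> is_derive y 1 f (th y))
  (th0 : forall y, U y -> 0 < th y).

Lemma increasing_on_interval x y : U x -> U y -> x < y -> f x < f y.
Proof.
move=> Ux Uy xy.
have Ut t : x <= t <= y -> U t by exact: Uitv.
apply: (@lt_of_pos_derivative f th) => //.
- by apply: (@within_continuous_der _ th) => t /Ut/df.
- by move=> t /andP[/ltW xt /ltW ty]; apply: df; apply: Ut; rewrite xt ty.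
- by move=> t /andP[/ltW xt /ltW ty]; apply: th0; apply: Ut; rewrite xt ty.
Qed.

Lemma injective_on_interval x y : U x -> U y -> f x = f y -> x = y.
Proof.
move=> Ux Uy fxy; have [xy|yx|//] := ltgtP x y.
- by have := increasing_on_interval Ux Uy xy; rewrite fxy ltxx.
- by have := increasing_on_interval Uy Ux yx; rewrite fxy ltxx.
Qed.

Lemma intermediate_value x y c : U x -> U y -> f x <= c -> c <= f y ->
  exists z, U z /\ f z = c.
Proof.
move=> Ux Uy fxc cfy; have [xy|yx] := leP x y; last first.
  by have := increasing_on_interval Uy Ux yx; lra.
have Ut t : x <= t <= y -> U t by exact: Uitv.
have cf : {within `[x, y], continuous f}.
  by apply: (@within_continuous_der _ th) => t /Ut/df.
have [|z zxy fz] := @IVT R f x y c xy cf.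
  by rewrite ge_min fxc le_max cfy orbT.
by exists z; split=> //; apply: Ut; rewrite in_itv/= in zxy.
Qed.

Lemma inverse_on_interval : exists g : R -> R,
  (forall y, U y -> g (f y) = y) /\
  (forall y, U y -> is_derive (f y) 1 g (th y)^-1).
Proof.
pose g t := xget 0 [set y | U y /\ f y = t].
have gf y : U y -> g (f y) = y.
  move=> Uy; rewrite /g; case: xgetP => [z -> [Uz fz]|/(_ y)].
    exact: injective_on_interval.
  by case.
exists g; split=> // y Uy.
apply: is_derive_inverse.
- by apply: filterS (Uop Uy) => z Uz; exact: gf.
- by apply: filterS (Uop Uy) => z Uz; exact: der_continuous (df Uz).
- exact: df.
- by rewrite lt0r_neq0// th0.
Qed.

End InverseFunction.

(** * The conserved quantity and the clock of the flow *)

Section PoleFlow.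
Context {R : realType}.
Implicit Types (k y v w t : R).

Definition flow_invariant v w : R := (w / v - 2) / w ^+ 2.

(** The component, on the side of [w0], of the values of [w] compatible with
    [v > 0], since [w / v = 2 + k w^2]. *)
Definition flow_range k (w0 : R) : set R :=
  [set y | 0 < y * w0 /\ 0 < y * (2 + k * y ^+ 2)].

(** As [w' = (2 + k w^2)^2 / 4] along the flow, a primitive of
    [4 / (2 + k y^2)^2] evaluated at [w] measures time. *)
Definition clock k (f : R -> R) : Prop :=
  forall y : R, 2 + k * y ^+ 2 != 0 -> is_derive y 1 f (4 / (2 + k * y ^+ 2) ^+ 2).

Lemma flow_range_neq0 k (w0 y : R) : flow_range k w0 y ->
  y != 0 /\ 2 + k * y ^+ 2 != 0.
Proof.
move=> [yw yg]; split.
  by apply: contraTneq yw => ->; rewrite mul0r ltxx.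
by apply: contraTneq yg => ->; rewrite mulr0 ltxx.
Qed.

Lemma flow_range_open k (w0 : R) : open (flow_range k w0).
Proof.
apply: openI.
- apply: (@open_comp _ _ (fun y => y * w0) [set z | 0 < z]); last exact: open_gt.
  by move=> y _; apply: (der_continuous (derM (der_id y) (der_cst w0 y))).
- apply: (@open_comp _ _ (fun y => y * (2 + k * y ^+ 2)) [set z | 0 < z]); last exact: open_gt.
  move=> y _; apply: (der_continuous (derM (der_id y)
    (derD (der_cst 2 y) (derM (der_cst k y) (derX 2 (der_id y)))))).
Qed.

(** On each side of [0], [y^2] is monotone, so [2 + k y^2] lies between its
    values at the ends of a segment. *)
Lemma flow_range_interval k (w0 : R) : is_interval (flow_range k w0).
Proof.
move=> a b [a1 a2] [b1 b2] y /andP[ay yb].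
have sq (s t : R) : 0 <= s -> s <= t -> s ^+ 2 <= t ^+ 2 by move=> s0 st; nra.
have [w00|w00|w00] := ltgtP w0 0; last by rewrite w00 mulr0 ltxx in a1.
- have a0 : a < 0 by nra.
  have b0 : b < 0 by nra.
  have ga : 2 + k * a ^+ 2 < 0 by nra.
  have gb : 2 + k * b ^+ 2 < 0 by nra.
  have y0 : y < 0 by lra.
  have h1 : y ^+ 2 <= a ^+ 2 by nra.
  have h2 : b ^+ 2 <= y ^+ 2 by nra.
  have k0 : k < 0 by nra.
  have gy : 2 + k * y ^+ 2 < 0 by nra.
  by split; nra.
- have a0 : 0 < a by nra.
  have b0 : 0 < b by nra.
  have ga : 0 < 2 + k * a ^+ 2 by nra.
  have gb : 0 < 2 + k * b ^+ 2 by nra.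
  have y0 : 0 < y by lra.
  have h1 : y ^+ 2 <= b ^+ 2 by nra.
  have h2 : a ^+ 2 <= y ^+ 2 by nra.
  have gy : 0 < 2 + k * y ^+ 2 by have [?|?] := leP 0 k; nra.
  by split; nra.
Qed.

Lemma clock_der k f (w0 y : R) : clock k f -> flow_range k w0 y ->
  is_derive y 1 f (4 / (2 + k * y ^+ 2) ^+ 2).
Proof. by move=> fP /flow_range_neq0[_ g0]; exact: fP. Qed.

Lemma clock_der_gt0 k (w0 y : R) : flow_range k w0 y ->
  0 < 4 / (2 + k * y ^+ 2) ^+ 2.
Proof.
by move=> /flow_range_neq0[_ g0]; rewrite divr_gt0// exprn_even_gt0.
Qed.

Lemma primitive_inv_quadratic k : exists S : R -> R,
  (forall y : R, 2 + k * y ^+ 2 != 0 -> is_derive y 1 S (2 + k * y ^+ 2)^-1) /\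
  (0 < k -> exists l : R, S y @[y --> +oo] --> l).
Proof.
have [k0|k0|->] := ltgtP k 0.
- pose s := Num.sqrt (- k / 2).
  have s0 : 0 < s by rewrite sqrtr_gt0; lra.
  have kE : k = - 2 * s ^+ 2 by rewrite sqr_sqrtr; lra.
  have s1 := lt0r_neq0 s0.
  exists (fun y => (8 * s)^-1 * (ln ((1 + s * y) ^+ 2) - ln ((1 - s * y) ^+ 2))).
  split=> [y|]; last by move=> h; lra.
  rewrite kE (_ : 2 + _ = 2 * ((1 + s * y) * (1 - s * y))); last by ring.
  rewrite !mulf_eq0 !negb_or => /and3P[_ y1 y2].
  deriv.
  + by rewrite exprn_even_gt0.
  + by rewrite exprn_even_gt0.
  + by field; rewrite s1 y1 y2.
- pose s := Num.sqrt (k / 2).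
  have s0 : 0 < s by rewrite sqrtr_gt0; lra.
  have kE : k = 2 * s ^+ 2 by rewrite sqr_sqrtr; lra.
  have s1 := lt0r_neq0 s0.
  exists (fun y => (2 * s)^-1 * atan ((y - 0) / s^-1)); split=> [y|_].
    rewrite kE => g0; deriv; field; rewrite g0 s1 /=.
    by apply: lt0r_neq0; have := sqr_ge0 (y * s); lra.
  by exists ((2 * s)^-1 * (pi / 2)); apply: cvgMl_tmp; apply: cvgy_atan_affine; rewrite ?invr_gt0.
- exists (fun y => y / 2); split=> [y _|]; last by [].
  by deriv; field.
Qed.

(** Since [4 / (2 + k y^2)^2] is [(y / (2 + k y^2))' + 1 / (2 + k y^2)], only the
    inverse of the quadratic remains to be integrated; for [k > 0] both terms
    have limits at infinity. *)
Lemma clock_exists k : exists f : R -> R, clock k f /\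
  (0 < k -> exists l : R, f y @[y --> +oo] --> l).
Proof.
have [S [dS Sl]] := primitive_inv_quadratic k.
exists (fun y => y / (2 + k * y ^+ 2) + S y); split=> [y g0|k0].
  have hS := dS y g0; deriv; first exact: g0.
  by field.
have [l Sl'] := Sl k0; exists (0 + l); apply: cvgD Sl'.
pose s := Num.sqrt (2 / k).
have s0 : 0 < s by rewrite sqrtr_gt0 divr_gt0.
have kE : k = 2 / s ^+ 2.
  by rewrite sqr_sqrtr ?divr_ge0 ?ltW//; field; rewrite lt0r_neq0.
have s1 := lt0r_neq0 s0.
have [_] := cvg_quadratic_decay s0 (near_pinfty_neq 0) (cvgy_invB 0).
move/(cvgMl_tmp (a := s ^+ 2 / 2)); rewrite mulr0; apply: cvg_trans.
apply: near_eq_cvg; near=> y; rewrite /= subr0 kE; field.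
have s2 : 0 < s ^+ 2 by rewrite exprn_gt0.
have y2 := sqr_ge0 y.
by rewrite s1 !lt0r_neq0//; lra.
Unshelve. all: by end_near. Qed.

End PoleFlow.

(** * Every flow follows the clock *)

Section FlowUniqueness.
Context {R : realType}.
Implicit Types (v w : R -> R) (f : R -> R) (T : \bar R).

Lemma lifespan_segment T (t : R) : lifespan T t -> `[0, t] `<=` lifespan T.
Proof.
move=> [t0 tT] s /=; rewrite in_itv/= => /andP[s0 st]; split=> //.
by apply: le_lt_trans tT; rewrite lee_fin.
Qed.

Lemma lifespan_interior T (s : R) : 0 < s -> lifespan T s -> (lifespan T)° s.
Proof.
move=> s0 [_ sT]; have [r sr rT] : exists2 r : R, s < r & (r%:E <= T)%E.
  case: T sT => [r| |] //= sT; first by exists r.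
  by exists (s + 1); [rewrite ltrDl|rewrite leey].
apply: (@filterS _ _ _ `]0, r[).
  move=> u /=; rewrite in_itv/= => /andP[u0 ur]; split; first exact: ltW.
  by apply: lt_le_trans rT; rewrite lte_fin.
by apply: near_in_itvoo; rewrite in_itv/= s0.
Qed.

Lemma within_comp (A : set R) (f g : R -> R) : {within A, continuous f} ->
  (forall x, A x -> {for f x, continuous g}) ->
  {within A, continuous (fun x => g (f x))}.
Proof.
move=> /subspace_continuousP cf cg; apply/subspace_continuousP => x Ax.
by apply: (continuous_cvg _ (cg x Ax)); exact: cf.
Qed.

Section Uniqueness.
Variables (T : \bar R) (v w : R -> R).
Hypothesis vw : pole_flow 1 (lifespan T) v w.

Let k := flow_invariant (v 0) (w 0).

Lemma invariant_constant t : lifespan T t -> flow_invariant (v t) (w t) = k.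
Proof.
move=> Jt; case: vw => vw0 cv cw dvw.
have t0 : 0 <= t by case: Jt.
have sub := lifespan_segment Jt.
apply: (@constant_on_segment _ (fun s => flow_invariant (v s) (w s)) 0 t t0).
- have cv' := continuous_subspaceW sub cv; have cw' := continuous_subspaceW sub cw.
  move: cv' cw' => /subspace_continuousP cv' /subspace_continuousP cw'.
  apply/subspace_continuousP => s st; have [v0 w0] := vw0 s (sub s st).
  have cvs := cv' s st; have cws := cw' s st.
  apply: cvgM; last by apply: cvgV; [rewrite expf_neq0|apply: cvgM; exact: cws].
  apply: cvgB; last exact: cvg_cst.
  by apply: cvgM; [exact: cws|apply: cvgV; [exact: lt0r_neq0|exact: cvs]].
- move=> s /andP[s0 st].
  have Js : lifespan T s by apply: sub; rewrite /= in_itv/= !ltW.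
  have [v0 w0] := vw0 s Js; have [dv dw] := dvw s (lifespan_interior s0 Js).
  have v1 := lt0r_neq0 v0; rewrite /flow_invariant.
  deriv; [exact: v1|by rewrite expf_neq0|].
  by field; rewrite v1 w0.
Qed.

Lemma flow_slope t : lifespan T t -> 2 + k * w t ^+ 2 = w t / v t.
Proof.
move=> Jt; rewrite -(invariant_constant Jt) /flow_invariant.
case: vw => vw0 _ _ _; have [v0 w0] := vw0 t Jt.
by field; rewrite lt0r_neq0.
Qed.

(** [w] does not vanish, hence keeps its sign, and
    [w (2 + k w^2) = w^2 / v > 0]. *)
Lemma flow_in_range t : lifespan T t -> flow_range k (w 0) (w t).
Proof.
move=> Jt; case: (vw) => vw0 cv cw dvw; have t0 : 0 <= t by case: Jt.
have sub := lifespan_segment Jt; have [vt0 wt0] := vw0 t Jt.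
split; last first.
  rewrite flow_slope// mulrA divr_gt0// -expr2 exprn_even_gt0//.
have J0 : lifespan T 0 by apply: sub; rewrite /= in_itv/= lexx.
have [_ w00] := vw0 0 J0.
rewrite ltNge; apply/negP => neg.
have [|z] := @IVT R w 0 t 0 t0 (continuous_subspaceW sub cw).
  rewrite ge_min le_max; have [w0|w0|w0] := ltgtP (w 0) 0.
  - by have -> : 0 <= w t by nra.
  - by have -> : w t <= 0 by nra.
  - by [].
move=> zt wz; have Jz : lifespan T z by exact: sub.
by have [_] := vw0 z Jz; rewrite wz eqxx.
Qed.

Lemma flow_clock f t : clock k f -> lifespan T t -> f (w t) = f (w 0) + t.
Proof.
move=> fP Jt; case: (vw) => vw0 cv cw dvw; have t0 : 0 <= t by case: Jt.
have sub := lifespan_segment Jt.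
have df s : lifespan T s -> is_derive (w s) 1 f (4 / (2 + k * w s ^+ 2) ^+ 2).
  by move=> Js; exact: clock_der fP (flow_in_range Js).
have := @constant_on_segment _ (fun s => f (w s) - s) 0 t t0.
rewrite subr0 => h; suff: f (w t) - t = f (w 0) by move=> <-; ring.
apply: h.
- have /subspace_continuousP cf := within_comp (continuous_subspaceW sub cw)
    (fun s st => der_continuous (df s (sub s st))).
  apply/subspace_continuousP => s st; apply: cvgB; first exact: cf.
  exact: cvg_within_filter.
- move=> s /andP[s0 st].
  have Js : lifespan T s by apply: sub; rewrite /= in_itv/= !ltW.
  have [v0 w0] := vw0 s Js; have [dv dw] := dvw s (lifespan_interior s0 Js).
  have h1 := der_comp dw (df s Js).
  apply: (der_eq (derD h1 (derN (der_id s)))).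
  by rewrite flow_slope//; field; rewrite lt0r_neq0.
Qed.

End Uniqueness.

End FlowUniqueness.

(** * Existence and maximality of the flow *)

Section FlowExistence.
Context {R : realType}.
Variables (v0 w0 : R).
Hypotheses (v00 : 0 < v0) (w00 : w0 != 0).

Let k := flow_invariant v0 w0.

Lemma initial_slope : 2 + k * w0 ^+ 2 = w0 / v0.
Proof. by rewrite /k /flow_invariant; field; rewrite w00 lt0r_neq0. Qed.

Lemma initial_in_range : flow_range k w0 w0.
Proof.
by split; rewrite ?initial_slope ?mulrA ?divr_gt0// -expr2 exprn_even_gt0.
Qed.

Variable f : R -> R.
Hypothesis fP : clock k f.

Lemma clock_increasing (y z : R) : flow_range k w0 y -> flow_range k w0 z ->
  y < z -> f y < f z.
Proof.
exact: (increasing_on_interval (flow_range_interval (w0 := w0))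
  (fun t => clock_der fP) (@clock_der_gt0 _ _ _)).
Qed.

Lemma clock_intermediate (y z c : R) : flow_range k w0 y -> flow_range k w0 z ->
  f y <= c -> c <= f z -> exists t, flow_range k w0 t /\ f t = c.
Proof.
exact: (intermediate_value (flow_range_interval (w0 := w0))
  (fun t => clock_der fP) (@clock_der_gt0 _ _ _)).
Qed.

(** [w t] is the point of the range where the clock shows [f w0 + t], and
    [v = w / (2 + k w^2)].  Any other flow with the same data follows the same
    clock, so it agrees with this one, and it cannot last longer than [L] because
    the clock stays below [f w0 + L] on the whole range. *)
Lemma maximal_flow_of_clock (L : \bar R) :
  (forall y, flow_range k w0 y -> ((f y - f w0)%:E < L)%E) ->
  (forall t, lifespan L t -> exists y, flow_range k w0 y /\ f y = f w0 + t) ->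
  exists v w : R -> R, maximal_pole_flow 1 L v0 w0 v w /\
    forall t, lifespan L t ->
      [/\ flow_range k w0 (w t), f (w t) = f w0 + t &
          v t = w t / (2 + k * w t ^+ 2)].
Proof.
move=> fL fsurj.
have [g [gf dg]] := inverse_on_interval (flow_range_open (w0 := w0))
  (flow_range_interval (w0 := w0)) (fun t => clock_der fP) (@clock_der_gt0 _ k w0).
pose w t := g (f w0 + t); pose v t := w t / (2 + k * w t ^+ 2).
have wP t : lifespan L t -> flow_range k w0 (w t) /\ f (w t) = f w0 + t.
  by move=> /fsurj[y [Uy fy]]; rewrite /w -fy gf.
have L0 : (0 < L)%E by have := fL _ initial_in_range; rewrite subrr.
have dw t : lifespan L t -> is_derive t 1 w ((2 + k * w t ^+ 2) ^+ 2 / 4).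
  move=> Lt; have [Uw fw] := wP t Lt.
  have := dg _ Uw; rewrite fw => h.
  apply: (der_eq (der_comp (derD (der_cst (f w0) t) (der_id t)) h)).
  have [_ g0] := flow_range_neq0 Uw.
  by field; rewrite g0.
have dv t : lifespan L t -> is_derive t 1 v (1 - (2 + k * w t ^+ 2) / 4).
  move=> Lt; have [Uw fw] := wP t Lt; have hw := dw t Lt.
  have [_ g0] := flow_range_neq0 Uw.
  by rewrite /v; deriv; [exact: g0|field].
have slope t : lifespan L t -> w t / v t = 2 + k * w t ^+ 2.
  move=> Lt; have [/flow_range_neq0[w1 g1] _] := wP t Lt.
  by rewrite /v; field; rewrite w1 g1.
have vw0 t : lifespan L t -> 0 < v t /\ w t != 0.
  move=> Lt; have [Uw _] := wP t Lt; have [w1 g1] := flow_range_neq0 Uw.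
  split=> //; case: Uw => _ wg; rewrite /v.
  rewrite (_ : _ / _ = w t * (2 + k * w t ^+ 2) / (2 + k * w t ^+ 2) ^+ 2).
    by rewrite divr_gt0// exprn_even_gt0.
  by field.
have flow : pole_flow 1 (lifespan L) v w.
  split=> [//|||t /interior_subset Lt].
  - by apply: continuous_in_subspaceT => t /set_mem/dv; exact: der_continuous.
  - by apply: continuous_in_subspaceT => t /set_mem/dw; exact: der_continuous.
  - have [v1 w1] := vw0 t Lt; have sl := slope t Lt; split.
      apply: (der_eq (dv t Lt)); rewrite -sl.
      by field; rewrite lt0r_neq0.
    apply: (der_eq (dw t Lt)); rewrite -sl.
    by field; rewrite lt0r_neq0.
have w_0 : w 0 = w0 by rewrite /w addr0 gf//; exact: initial_in_range.
have v_0 : v 0 = v0.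
  by rewrite /v w_0 initial_slope; field; rewrite w00 lt0r_neq0.
exists v, w; split; last by move=> t Lt; have [] := wP t Lt.
split=> // T v' w' flow' v'0 w'0.
have kE : flow_invariant (v' 0) (w' 0) = k by rewrite v'0 w'0.
have clock' t : lifespan T t -> flow_range k w0 (w' t) /\ f (w' t) = f w0 + t.
  move=> Tt; have := flow_in_range flow' Tt; have := @flow_clock _ _ _ _ flow' f t.
  by rewrite kE w'0 => h1 h2; split=> //; exact: h1.
split.
  rewrite leNgt; apply/negP => LT.
  case: L L0 fL LT {fsurj wP dw dv slope vw0 flow} => [l| |]// l0 fL LT; last by rewrite ltNge leey in LT.
  rewrite lte_fin in l0.
  have /clock'[Uw fw] : lifespan T l by split=> //; exact: ltW.
  by have := fL _ Uw; rewrite fw addrAC subrr add0r lte_fin ltxx.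
move=> t Tt; have [Uw fw] := clock' t Tt.
have wE : w t = w' t by rewrite /w -fw gf.
split; last by rewrite wE.
rewrite /v wE.
have [/(_ t Tt)[v1 w1] _ _ _] := flow'.
rewrite -kE (flow_slope flow' Tt).
by field; rewrite w1 lt0r_neq0.
Qed.

End FlowExistence.

(** * Global existence when [w0 / v0 <= 2] *)

Section GlobalFlow.
Context {R : realType}.
Variables (v0 w0 : R).
Hypotheses (v00 : 0 < v0) (w00 : w0 != 0) (slope2 : w0 / v0 <= 2).

Let k := flow_invariant v0 w0.

Let k_le0 : k <= 0.
Proof.
by rewrite /k /flow_invariant ler_pdivrMr ?mul0r ?subr_le0// exprn_even_gt0.
Qed.

Lemma der_slope_ratio (y : R) : 2 + k * y ^+ 2 != 0 ->
  is_derive y 1 (fun y => y / (2 + k * y ^+ 2))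
    ((2 - k * y ^+ 2) / (2 + k * y ^+ 2) ^+ 2).
Proof. by move=> g0; deriv; [exact: g0|field]. Qed.

(** The equation [y / (2 + k y^2) = V] is quadratic in [y]; its roots are
    [4 V / (1 + s)] with [s^2 = 1 - 8 k V^2], and the sign of [w0] selects the
    root that lies in the range. *)
Lemma pole_height_surjective (V : R) : 0 < V ->
  exists y, flow_range k w0 y /\ y / (2 + k * y ^+ 2) = V.
Proof.
move=> V0; pose r := Num.sqrt (1 - 8 * k * V ^+ 2).
have kV : 0 <= - (k * V ^+ 2) by rewrite oppr_ge0 mulr_le0_ge0 ?sqr_ge0.
have r2 : r ^+ 2 = 1 - 8 * k * V ^+ 2 by rewrite sqr_sqrtr; lra.
have r0 : 0 <= r by exact: sqrtr_ge0.
have main s : s ^+ 2 = r ^+ 2 -> 1 + s != 0 -> 0 < (1 + s) * w0 ->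
    exists y, flow_range k w0 y /\ y / (2 + k * y ^+ 2) = V.
  move=> s2 s1 sw; have V1 := lt0r_neq0 V0.
  have p2 : 0 < (1 + s) ^+ 2 by rewrite exprn_even_gt0.
  have kE : k = (1 - s ^+ 2) / (8 * V ^+ 2) by rewrite s2 r2; field.
  have gE : 2 + k * (4 * V / (1 + s)) ^+ 2 = 4 / (1 + s) by rewrite kE; field; rewrite V1 s1.
  exists (4 * V / (1 + s)); rewrite /flow_range/= gE; split; last first.
    by field; rewrite s1.
  split.
    rewrite (_ : _ * w0 = 4 * V * ((1 + s) * w0) / (1 + s) ^+ 2); last by field.
    by apply: divr_gt0 p2; rewrite mulr_gt0// mulr_gt0.
  rewrite (_ : _ * _ = 16 * V / (1 + s) ^+ 2); last by field.
  by apply: divr_gt0 p2; rewrite mulr_gt0.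
have [w0n|w0p|/eqP] := ltgtP w0 0; last by rewrite (negPf w00).
- have k0 : k < 0.
    have ws : w0 / v0 < 0 by rewrite pmulr_llt0 ?invr_gt0.
    by rewrite /k /flow_invariant ltr_pdivrMr ?exprn_even_gt0// mul0r; lra.
  have kV1 : k * V ^+ 2 < 0 by rewrite nmulr_rlt0// exprn_gt0.
  have r1 : 1 < r by nra.
  apply: (main (- r)); first by rewrite sqrrN.
    by apply: ltr0_neq0; lra.
  by rewrite nmulr_lgt0//; lra.
- apply: (main r) => //; first by apply: lt0r_neq0; lra.
  by rewrite pmulr_lgt0//; lra.
Qed.

Variable f : R -> R.
Hypothesis fP : clock k f.

(** By monotonicity of [C f - y / (2 + k y^2)] to the right of [w0], where
    [C = 1 - k w0^2 / 4] bounds the growth rate of [v], at the point where [v]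
    would be [v0 + C t] the clock is at least [f w0 + t]. *)
Lemma clock_unbounded (t : R) : 0 <= t ->
  exists y, flow_range k w0 y /\ f y = f w0 + t.
Proof.
rewrite le_eqVlt => /predU1P[<-|t0].
  by exists w0; rewrite addr0; split=> //; exact: initial_in_range.
have Uw0 : flow_range k w0 w0 by exact: initial_in_range.
pose C := 1 - k * w0 ^+ 2 / 4.
have C1 : 1 <= C.
  by rewrite /C lerDl oppr_ge0 pmulr_lle0 ?invr_gt0// mulr_le0_ge0 ?sqr_ge0.
have Ct : 0 < C * t by rewrite mulr_gt0// (lt_le_trans _ C1).
have [y [Uy yV]] : exists y, flow_range k w0 y /\ y / (2 + k * y ^+ 2) = v0 + C * t.
  by apply: pole_height_surjective; rewrite addr_gt0.
have w0V : w0 / (2 + k * w0 ^+ 2) = v0.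
  by rewrite initial_slope//; field; rewrite w00 lt0r_neq0.
have Useg a b s : flow_range k w0 a -> flow_range k w0 b -> a <= s <= b ->
    flow_range k w0 s by move=> Ua Ub; exact: (flow_range_interval Ua Ub).
have kn s : 0 <= - (k * s ^+ 2) by rewrite oppr_ge0 mulr_le0_ge0 ?sqr_ge0.
have w0y : w0 <= y.
  rewrite leNgt; apply/negP => /ltW yw0.
  have := @le_of_nonneg_derivative _ _ _ y w0 yw0
    (fun s sy => der_slope_ratio (flow_range_neq0 (Useg _ _ _ Uy Uw0 sy)).2).
  rewrite w0V yV => h; have : v0 + C * t <= v0.
    apply: h => s _; rewrite mulr_ge0 ?invr_ge0 ?sqr_ge0//.
    by have := kn s; lra.
  by lra.
apply: (clock_intermediate fP Uw0 Uy); first by lra.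
have dF s : w0 <= s <= y -> is_derive s 1 (fun s => C * f s - s / (2 + k * s ^+ 2))
    ((4 * C - (2 - k * s ^+ 2)) / (2 + k * s ^+ 2) ^+ 2).
  move=> sy; have Us := Useg _ _ _ Uw0 Uy sy; have [_ g0] := flow_range_neq0 Us.
  apply: (der_eq (derD (derM (der_cst C s) (clock_der fP Us)) (derN (der_slope_ratio g0)))).
  by field.
have := le_of_nonneg_derivative w0y dF; rewrite yV w0V => h.
have : C * f w0 - v0 <= C * f y - (v0 + C * t).
  apply: h => s sy; have [Us1 Us2] := Useg _ _ _ Uw0 Uy sy.
  rewrite mulr_ge0 ?invr_ge0 ?sqr_ge0// /C.
  have [w0n|w0p|/eqP] := ltgtP w0 0; last by rewrite (negPf w00).
  - have s0 : s < 0 by nra.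
    have sw : s ^+ 2 <= w0 ^+ 2 by case/andP: sy; nra.
    have : k * w0 ^+ 2 <= k * s ^+ 2 by rewrite ler_wnM2l.
    by lra.
  - have s0 : 0 < s by nra.
    have gs : 0 < 2 + k * s ^+ 2 by nra.
    by have := kn w0; lra.
move=> h1; have : C * (f w0 + t) <= C * f y by lra.
by rewrite ler_pM2l// (lt_le_trans _ C1).
Qed.

End GlobalFlow.

Section GlobalFlowTheorem.
Context {R : realType}.

(** The pole recedes since [v' = 1 - (2 + k w^2) / 4 >= 1 / 2]. *)
Lemma global_flow (v0 w0 : R) : 0 < v0 -> w0 != 0 -> w0 / v0 <= 2 ->
  exists v w : R -> R, maximal_pole_flow 1 +oo v0 w0 v w /\
    forall s t, 0 <= s -> s < t -> v s < v t.
Proof.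
move=> v00 w00 slope2; set k := flow_invariant v0 w0.
have k0 : k <= 0.
  by rewrite /k /flow_invariant ler_pdivrMr ?mul0r ?subr_le0// exprn_even_gt0.
have [f [fP _]] := clock_exists k.
have [|t [t0 _]|v [w [vw wP]]] := @maximal_flow_of_clock _ _ _ v00 w00 f fP +oo%E.
- by move=> y _; rewrite ltry.
- exact: clock_unbounded.
exists v, w; split=> // s t s0 st.
have [flow v_0 w_0 _] := vw; have [vw0 cv cw dvw] := flow.
have Lt (r : R) : 0 <= r -> lifespan +oo%E r by move=> ?; split=> //; rewrite ltry.
apply: (@lt_of_pos_derivative _ v (fun r => - (w r / (4 * v r) - 1))) => //.
- apply: continuous_subspaceW cv => r /=; rewrite in_itv/= => /andP[sr _].
  by apply: Lt; exact: le_trans sr.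
- move=> r /andP[sr _]; have r0 : 0 < r by exact: le_lt_trans sr.
  by have [] := dvw r (lifespan_interior r0 (Lt r (ltW r0))).
- move=> r /andP[sr _]; have r0 : 0 <= r by lra.
  have sl := flow_slope flow (Lt r r0).
  have [vr0 _] := vw0 r (Lt r r0).
  rewrite (_ : w r / (4 * v r) = w r / v r / 4); last by field; rewrite lt0r_neq0.
  have : k * w r ^+ 2 <= 0 by rewrite mulr_le0_ge0 ?sqr_ge0.
  by rewrite -sl v_0 w_0 -/k; lra.
Qed.

End GlobalFlowTheorem.

(** * Blow-up when [w0 / v0 > 2] *)

Lemma equiv_of_ratio (R : realType) (tc : R) (f g p : R -> R) :
  (\forall t \near tc^'-, f t = p t * g t) -> p t @[t --> tc^'-] --> (1 : R) ->
  f ~_(tc^'-) g.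
Proof.
move=> fpg p1; apply/eqaddoP => e e0; near=> t.
have ft : f t = p t * g t by near: t.
have -> : (f - g) t = (p t - 1) * g t.
  by change (f t - g t = (p t - 1) * g t); rewrite ft; ring.
rewrite normrM ler_wpM2r//; near: t.
move/cvgrPdist_le : p1 => /(_ e e0); apply: filterS => t.
by rewrite distrC.
Unshelve. all: by end_near. Qed.

(** A nonnegative quantity whose cube tends to [1] tends to [1]. *)
Lemma dist1_cube_ge (R : realFieldType) (q : R) : 0 <= q ->
  `|q - 1| <= `|q ^+ 3 - 1|.
Proof.
move=> q0; rewrite (_ : q ^+ 3 - 1 = (q - 1) * (q ^+ 2 + q + 1)); last by ring.
rewrite normrM ler_peMr// ger0_norm; have := sqr_ge0 q; lra.
Qed.

Section Blowup.
Context {R : realType}.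
Variables (v0 w0 : R).
Hypotheses (v00 : 0 < v0) (slope2 : 2 < w0 / v0).

Let k := flow_invariant v0 w0.

Let w0p : 0 < w0.
Proof.
have h : 0 < w0 / v0 by exact: lt_trans slope2.
by rewrite pmulr_lgt0 ?invr_gt0 in h.
Qed.

Let w00 : w0 != 0. Proof. exact: lt0r_neq0. Qed.

Let kp : 0 < k.
Proof. by rewrite /k /flow_invariant divr_gt0 ?subr_gt0// exprn_gt0. Qed.

Variables (f : R -> R) (l : R).
Hypotheses (fP : clock k f) (fl : f y @[y --> +oo] --> l).

Lemma slope_gt0 (y : R) : 0 < 2 + k * y ^+ 2.
Proof. by have := mulr_ge0 (ltW kp) (sqr_ge0 y); lra. Qed.

Lemma flow_range_gt0 (y : R) : flow_range k w0 y <-> 0 < y.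
Proof.
split=> [[]|y0]; first by rewrite pmulr_lgt0.
by split; rewrite mulr_gt0// slope_gt0.
Qed.

Lemma clock_lt_limit (y : R) : 0 < y -> f y < l.
Proof.
move=> y0; have lt : f y < f (y + 1).
  by apply: (clock_increasing fP); rewrite ?flow_range_gt0//; lra.
apply: (lt_le_trans lt); apply: cvgr_to_ge fl _.
near=> z; have : y + 1 < z by near: z; apply: nbhs_pinfty_gt; exact: num_real.
by move=> yz; apply/ltW/(clock_increasing fP) => //; apply/flow_range_gt0; lra.
Unshelve. all: by end_near. Qed.

Lemma clock_below_limit (t : R) : 0 <= t -> t < l - f w0 ->
  exists y, flow_range k w0 y /\ f y = f w0 + t.
Proof.
move=> t0 tl; have [y [y0 fy]] : exists y, 0 < y /\ f w0 + t < f y.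
  have h : \forall y \near +oo, 0 < y /\ f w0 + t < f y.
    near=> y; split; near: y; first by apply: nbhs_pinfty_gt; exact: num_real.
    by apply: (cvgr_gt _ fl); lra.
  by have [y] := filter_ex h; exists y.
apply: (clock_intermediate fP (y := w0) (z := y)).
- exact/flow_range_gt0.
- exact/flow_range_gt0.
- by lra.
- exact: ltW.
Unshelve. all: by end_near. Qed.

(** Integrating [4 / (2 + k s^2)^2 <= 4 / (k s^2)^2] from [y] to infinity. *)
Lemma clock_remainder_le (y : R) : 0 < y -> l - f y <= 4 / (3 * k ^+ 2 * y ^+ 3).
Proof.
move=> y0; have k1 := lt0r_neq0 kp.
suff : l <= f y + 4 / (3 * k ^+ 2 * y ^+ 3) by lra.
apply: cvgr_to_le fl _; near=> z.
have yz : y <= z by near: z; apply: nbhs_pinfty_ge; exact: num_real.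
pose F s := - (f s + 4 / (3 * k ^+ 2) * (s ^+ 3)^-1).
have dF s : y <= s <= z -> is_derive s 1 F
    (4 / (k ^+ 2 * s ^+ 4) - 4 / (2 + k * s ^+ 2) ^+ 2).
  move=> /andP[ys _]; have s0 : 0 < s by exact: lt_le_trans ys.
  have s1 := lt0r_neq0 s0; have g1 := lt0r_neq0 (slope_gt0 s); have df := fP g1.
  rewrite /F; deriv; first by rewrite expf_neq0.
  by field; rewrite s1 k1 g1.
have := le_of_nonneg_derivative yz dF; rewrite /F => h.
have z0 : 0 < z by exact: lt_le_trans yz.
have : 0 <= 4 / (3 * k ^+ 2) * (z ^+ 3)^-1.
  apply: mulr_ge0; last by rewrite invr_ge0 exprn_ge0// ltW.
  by apply: divr_ge0 => //; apply: mulr_ge0 => //; exact: sqr_ge0.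
rewrite (_ : 4 / (3 * k ^+ 2 * y ^+ 3) = 4 / (3 * k ^+ 2) * (y ^+ 3)^-1); last first.
  by field; rewrite k1 lt0r_neq0.
suff : - (f y + 4 / (3 * k ^+ 2) * (y ^+ 3)^-1)
   <= - (f z + 4 / (3 * k ^+ 2) * (z ^+ 3)^-1) by lra.
apply: h => s /andP[ys _]; have s0 : 0 < s by exact: lt_le_trans ys.
have X0 : 0 < k * s ^+ 2 by rewrite mulr_gt0// exprn_gt0.
rewrite (_ : k ^+ 2 * s ^+ 4 = (k * s ^+ 2) ^+ 2); last by ring.
have X2 : 0 < 2 + k * s ^+ 2 by lra.
rewrite subr_ge0 ler_wpM2l// lef_pV2 ?posrE ?exprn_gt0//.
by rewrite lerXn2r ?nnegrE ?(ltW X0) ?(ltW X2)//; lra.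
Unshelve. all: by end_near. Qed.

(** Integrating [4 / (2 + X)^2 >= 4 / X^2 - 16 / X^3] with [X = k s^2]. *)
Lemma clock_remainder_ge (y : R) : 0 < y ->
  4 / (3 * k ^+ 2 * y ^+ 3) - 16 / (5 * k ^+ 3 * y ^+ 5) <= l - f y.
Proof.
move=> y0; have k1 := lt0r_neq0 kp; have y1 := lt0r_neq0 y0.
pose F s := f s + 4 / (3 * k ^+ 2) * (s^-1) ^+ 3 - 16 / (5 * k ^+ 3) * s^-1 ^+ 5.
have dF (s : R) : 0 < s -> is_derive s 1 F (4 / (2 + k * s ^+ 2) ^+ 2
    - 4 / (k ^+ 2 * s ^+ 4) + 16 / (k ^+ 3 * s ^+ 6)).
  move=> s0; have s1 := lt0r_neq0 s0; have g1 := lt0r_neq0 (slope_gt0 s).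
  have df := fP g1; rewrite /F; deriv; [exact: s1|exact: s1|].
  by field; rewrite s1 k1 g1.
have Fl : F s @[s --> +oo] --> l.
  have i0 : s^-1 @[s --> +oo] --> (0 : R).
    by have := cvgy_invB (0 : R); under eq_fun do rewrite subr0.
  have i2 : (s^-1 * s^-1) @[s --> +oo] --> (0 * 0 : R) by exact: cvgM.
  have i3 : (s^-1 * (s^-1 * s^-1)) @[s --> +oo] --> (0 * (0 * 0) : R).
    exact: cvgM.
  have i5 : (s^-1 * (s^-1 * s^-1) * (s^-1 * s^-1)) @[s --> +oo] -->
    (0 * (0 * 0) * (0 * 0) : R) by exact: cvgM.
  have : (f s + 4 / (3 * k ^+ 2) * (s^-1 * (s^-1 * s^-1))
      - 16 / (5 * k ^+ 3) * (s^-1 * (s^-1 * s^-1) * (s^-1 * s^-1))) @[s --> +oo]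
    --> l + 4 / (3 * k ^+ 2) * (0 * (0 * 0))
      - 16 / (5 * k ^+ 3) * (0 * (0 * 0) * (0 * 0)).
    by apply: cvgB; [apply: cvgD => //|]; exact: cvgMl_tmp.
  rewrite !mulr0 addr0 subr0; apply: cvg_trans; apply: near_eq_cvg.
  by near=> s; rewrite /F /=; ring.
suff : F y <= l.
  rewrite /F (_ : 4 / (3 * k ^+ 2) * _ = 4 / (3 * k ^+ 2 * y ^+ 3)); last first.
    by field; rewrite k1 y1.
  rewrite (_ : 16 / (5 * k ^+ 3) * _ = 16 / (5 * k ^+ 3 * y ^+ 5)); last first.
    by field; rewrite k1 y1.
  by lra.
apply: cvgr_to_ge Fl _; near=> z.
have yz : y <= z by near: z; apply: nbhs_pinfty_ge; exact: num_real.
have dF' s : y <= s <= z -> is_derive s 1 F (4 / (2 + k * s ^+ 2) ^+ 2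
    - 4 / (k ^+ 2 * s ^+ 4) + 16 / (k ^+ 3 * s ^+ 6)).
  by move=> /andP[ys _]; apply: dF; exact: lt_le_trans ys.
apply: (le_of_nonneg_derivative yz dF') => s /andP[ys _].
have s0 : 0 < s by exact: lt_le_trans ys.
have X0 : 0 < k * s ^+ 2 by rewrite mulr_gt0// exprn_gt0.
rewrite (_ : k ^+ 2 * s ^+ 4 = (k * s ^+ 2) ^+ 2); last by ring.
rewrite (_ : k ^+ 3 * s ^+ 6 = (k * s ^+ 2) ^+ 3); last by ring.
move: (k * s ^+ 2) X0 => X X0.
have X1 := lt0r_neq0 X0; have X2 : 2 + X != 0 by apply: lt0r_neq0; lra.
rewrite (_ : _ + _ = (48 * X + 64) / ((2 + X) ^+ 2 * X ^+ 3)); last first.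
  by field; rewrite X1 X2.
have X2' : 0 < 2 + X by lra.
by apply: divr_ge0; [lra|rewrite mulr_ge0// exprn_ge0// ltW].
Unshelve. all: by end_near. Qed.

(** Put [c = (tc - t)^(1/3)] and [b = (3 / (4 k))^(1/3)].  The bounds on the
    remainder [tc - t = l - f (w t)] show that [q = k b c w] satisfies [q^3 -> 1],
    so [w] is equivalent to [1 / (k b c) = (4 b^2 / 3) / c] and
    [v = w / (2 + k w^2)] to [1 / (k w)], that is to [b c]. *)
Lemma blowup_asymptotics (v w : R -> R) : let tc := l - f w0 in
  (forall t, lifespan tc%:E t -> [/\ flow_range k w0 (w t), f (w t) = f w0 + t &
     v t = w t / (2 + k * w t ^+ 2)]) ->
  v t @[t --> tc^'-] --> 0 /\
      exists vt : R, [/\ 0 < vt,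
        v ~_(tc^'-) (fun t => vt * (tc - t) `^ (1 / 3)) &
        w ~_(tc^'-) (fun t => 4 * vt ^+ 2 / 3 * (tc - t) `^ (- (1 / 3)))].
Proof.
move=> tc vwP.
have tc0 : 0 < tc by rewrite subr_gt0; exact: clock_lt_limit.
have nearL : \forall t \near tc^'-, 0 < t < tc.
  near=> t; apply/andP; split; near: t; first exact: nbhs_left_gt.
  exact: nbhs_left_lt.
have Lt t : 0 < t < tc -> lifespan tc%:E t.
  by move=> /andP[/ltW ? ?]; split=> //; rewrite lte_fin.
have wy : w t @[t --> tc^'-] --> +oo.
  apply/cvgryPge => M.
  pose N := Num.max M 1; have N0 : 0 < N by rewrite lt_max ltr01 orbT.
  near=> t.
  have t0 : 0 < t < tc by near: t.
  have [Uw fw _] := vwP t (Lt t t0).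
  have Nt : f N - f w0 < t.
    near: t; apply: nbhs_left_gt; rewrite ltrD2r; exact: (clock_lt_limit N0).
  apply: (@le_trans _ _ N); first by rewrite le_max lexx.
  rewrite leNgt; apply/negP => wN.
  have := clock_increasing fP Uw (proj2 (flow_range_gt0 N) N0) wN.
  by rewrite fw; lra.
have w0' : \forall t \near tc^'-, 0 < w t.
  by near=> t; near: t; apply: (cvgry_gt wy).
have wi : (w t)^-1 @[t --> tc^'-] --> (0 : R) by apply/gtr0_cvgV0.
have k1 := lt0r_neq0 kp.
pose r t := 3 * k ^+ 2 / 4 * (tc - t) * w t ^+ 3.
have r1 : r t @[t --> tc^'-] --> (1 : R).
  apply: (@squeeze_cvgr _ _ _ _ (fun t => 1 - 12 / (5 * k) * ((w t)^-1 * (w t)^-1)) (cst 1)).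
  - near=> t; have t0 : 0 < t < tc by near: t.
    have wt0 : 0 < w t by near: t.
    have wt1 := lt0r_neq0 wt0.
    have [Uw fw _] := vwP t (Lt t t0).
    have tE : tc - t = l - f (w t) by rewrite fw /tc; ring.
    have w3 : 0 < 3 * k ^+ 2 / 4 * w t ^+ 3.
      by rewrite mulr_gt0 ?exprn_gt0// divr_gt0// mulr_gt0// exprn_gt0.
    have rE : r t = (l - f (w t)) * (3 * k ^+ 2 / 4 * w t ^+ 3) by rewrite /r tE; ring.
    have h1 := clock_remainder_le wt0; have h2 := clock_remainder_ge wt0.
    apply/andP; split.
      rewrite rE; move: h2; rewrite -(ler_pM2r w3); apply: le_trans.
      by rewrite le_eqVlt; apply/orP; left; apply/eqP; field; rewrite wt1 k1.
    rewrite rE /cst; move: h1; rewrite -(ler_pM2r w3) => h; apply: (le_trans h).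
    by rewrite le_eqVlt; apply/orP; left; apply/eqP; field; rewrite wt1 k1.
  - have : 1 - 12 / (5 * k) * ((w t)^-1 * (w t)^-1) @[t --> tc^'-]
       --> 1 - 12 / (5 * k) * (0 * 0).
      by apply: cvgB; [exact: cvg_cst|apply: cvgMl_tmp; exact: cvgM].
    by rewrite !mulr0 subr0.
  - exact: cvg_cst.
pose b := (3 / (4 * k)) `^ (1 / 3).
have b0 : 0 < b by rewrite powR_gt0// divr_gt0// mulr_gt0.
have b1 := lt0r_neq0 b0.
have cube (x : R) : 0 <= x -> (x `^ (1 / 3)) ^+ 3 = x.
  by move=> x0; rewrite -powR_mulrn ?powR_ge0// -powRrM div1r mulVf ?powRr1.
have b3 : b ^+ 3 = 3 / (4 * k) by rewrite cube// ltW// divr_gt0// mulr_gt0.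
pose c t := (tc - t) `^ (1 / 3).
have c3 t : t < tc -> 0 < c t /\ c t ^+ 3 = tc - t.
  by move=> ttc; split; [rewrite powR_gt0 ?subr_gt0|rewrite cube// subr_ge0 ltW].
pose q t := k * b * (c t * w t).
have kE : k = 3 / (4 * b ^+ 3) by rewrite b3; field.
have qr t : t < tc -> q t ^+ 3 = r t.
  move=> /c3[_ ct3]; rewrite /r -ct3 /q.
  rewrite [LHS](_ : _ = b ^+ 3 * k ^+ 3 * (c t ^+ 3 * w t ^+ 3)); last by ring.
  by rewrite b3; field.
have q1 : q t @[t --> tc^'-] --> (1 : R).
  apply/cvgrPdist_le => e e0; near=> t.
  have /andP[_ ttc] : 0 < t < tc by near: t.
  have wt0 : 0 < w t by near: t.
  have [ct0 _] := c3 t ttc.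
  rewrite distrC; apply: le_trans (dist1_cube_ge _) _.
    by rewrite /q mulr_ge0// ltW// mulr_gt0.
  rewrite qr// distrC; near: t; by move/cvgrPdist_le : r1; apply.
have near3 : \forall t \near tc^'-, [/\ lifespan tc%:E t, 0 < w t & t < tc].
  near=> t; have t0 : 0 < t < tc by near: t.
  by split; [exact: Lt|near: t|case/andP: t0].
split.
- apply: (@squeeze_cvgr _ _ _ _ (cst 0) (fun t => k^-1 * (w t)^-1)).
  + near=> t; have [Ltt wt0 _] : [/\ lifespan tc%:E t, 0 < w t & t < tc] by near: t.
    have [_ _ ->] := vwP t Ltt; have g0 := slope_gt0 (w t).
    apply/andP; split; first by rewrite divr_ge0// ltW.
    rewrite ler_pdivrMr// (_ : k^-1 * _ * _ = w t + 2 / (k * w t)); last first.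
      by field; rewrite k1 lt0r_neq0.
    by rewrite lerDl divr_ge0// mulr_ge0// ltW.
  + exact: cvg_cst.
  + have : k^-1 * (w t)^-1 @[t --> tc^'-] --> k^-1 * 0 by exact: cvgMl_tmp.
    by rewrite mulr0.
- exists b; split=> //.
  + apply: (@equiv_of_ratio _ _ _ _
      (fun t => (q t)^-1 * (1 + 2 / k * ((w t)^-1 * (w t)^-1))^-1)).
      near=> t; have [Ltt wt0 ttc] : [/\ lifespan tc%:E t, 0 < w t & t < tc] by near: t.
      have [_ _ ->] := vwP t Ltt; have g1 := lt0r_neq0 (slope_gt0 (w t)).
      have [ct0 _] := c3 t ttc; rewrite -/(c t) /q; field.
      have g2 : k * (w t * w t) + 2 != 0 by rewrite -expr2 addrC.
      by rewrite g2 k1 b1 !lt0r_neq0.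
    have : (q t)^-1 * (1 + 2 / k * ((w t)^-1 * (w t)^-1))^-1 @[t --> tc^'-]
        --> (1^-1 * (1 + 2 / k * (0 * 0))^-1 : R).
      apply: cvgM; apply: cvgV => //.
        by rewrite !mulr0 addr0 oner_neq0.
      by apply: cvgD; [exact: cvg_cst|apply: cvgMl_tmp; exact: cvgM].
    by rewrite !mulr0 addr0 invr1 mulr1.
  + apply: (@equiv_of_ratio _ _ _ _ q) => //.
    near=> t; have [Ltt wt0 ttc] : [/\ lifespan tc%:E t, 0 < w t & t < tc] by near: t.
    have [ct0 _] := c3 t ttc; have ct1 := lt0r_neq0 ct0.
    rewrite powRN -/(c t) /q.
    rewrite [RHS](_ : _ = 4 / 3 * k * b ^+ 3 * w t); last by field.
    by rewrite b3; field.
Unshelve. all: by end_near. Qed.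

End Blowup.

Section BlowupFlow.
Context {R : realType}.

Lemma omega_poleE (x0 : R) (v w : R -> R) t :
  omega_pole x0 v w ^~ t = omega_prof x0 (v t) (w t).
Proof. by []. Qed.

(** The sup norm is [(3 sqrt 3 / 4) (w / v) / v], which is at least [1 / v] as
    soon as [w / v >= 2]. *)
Lemma blowup_of_slope (x0 tc : R) (v w : R -> R) :
  (\forall t \near tc^'-, 0 < v t /\ 2 <= w t / v t) ->
  v t @[t --> tc^'-] --> 0 -> blows_up_at (omega_pole x0 v w) tc.
Proof.
move=> vw v_0; rewrite /blows_up_at.
have : (3 * Num.sqrt 3 / 4 * (`|w t / v t| / v t))%:E @[t --> tc^'-] --> +oo%E.
  apply/cvgeryP/cvgryPge => A; near=> t.
  have [vt0 wvt] : 0 < v t /\ 2 <= w t / v t by near: t.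
  apply: (@le_trans _ _ (v t)^-1).
    near: t; have : (v t)^-1 @[t --> tc^'-] --> +oo.
      by apply/cvgrVy => //; apply: filterS vw => t [].
    by move=> /cvgryPge; apply.
  have s1 : 1 <= Num.sqrt 3 :> R by rewrite -{1}(@sqrtr1 R) ler_wsqrtr// ler1n.
  rewrite mulrA ler_peMl ?invr_ge0 ?ltW//.
  rewrite ger0_norm; last by lra.
  have : 1 * 2 <= Num.sqrt 3 * (w t / v t) by apply: ler_pM.
  by lra.
apply: cvg_trans; apply: near_eq_cvg; near=> t.
have [vt0 wvt] : 0 < v t /\ 2 <= w t / v t by near: t.
by rewrite omega_poleE norm_Loo_omega.
Unshelve. all: by end_near. Qed.

Lemma blowup_flow (x0 v0 w0 : R) : 0 < v0 -> 2 < w0 / v0 ->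
  exists (tc : R) (v w : R -> R),
    [/\ 0 < tc,
        maximal_pole_flow 1 tc%:E v0 w0 v w,
        is_solution 1 (lifespan tc%:E)
          (omega_pole x0 v w) (u_pole x0 v w),
        v t @[t --> tc^'-] --> 0 /\
        blows_up_at (omega_pole x0 v w) tc &
        exists vt : R,
          [/\ 0 < vt,
              v ~_(tc^'-) (fun t => vt * (tc - t) `^ (1 / 3)) &
              w ~_(tc^'-)
                (fun t => 4 * vt ^+ 2 / 3 * (tc - t) `^ (- (1 / 3)))]].
Proof.
move=> v00 slope2.
have w0p : 0 < w0.
  have h : 0 < w0 / v0 by exact: lt_trans slope2.
  by rewrite pmulr_lgt0 ?invr_gt0 in h.
have w00 := lt0r_neq0 w0p.
set k := flow_invariant v0 w0.
have kp : 0 < k by rewrite /k /flow_invariant divr_gt0 ?subr_gt0// exprn_gt0.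
have [f [fP /(_ kp)[l fl]]] := clock_exists k.
have [y|t [t0 tl]|v [w [vw vwP]]] :=
    @maximal_flow_of_clock _ _ _ v00 w00 f fP (l - f w0)%:E.
- move=> /(flow_range_gt0 v00 slope2) y0.
  by rewrite lte_fin ltrD2r; exact: (clock_lt_limit v00 slope2 fP fl).
- exact: (clock_below_limit v00 slope2 fP fl).
have [flow _ _ _] := vw.
have [v_0 asym] := blowup_asymptotics v00 slope2 fP fl vwP.
have tc0 : 0 < l - f w0.
  by rewrite subr_gt0; exact: (clock_lt_limit v00 slope2 fP fl).
exists (l - f w0), v, w; split; [exact: tc0|exact: vw| | |exact: asym].
- exact: pole_solution flow.
- split; first exact: v_0.
  apply: blowup_of_slope v_0; near=> t.
  have Lt : lifespan (l - f w0)%:E t.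
    split; first by near: t; exact: nbhs_left_ge.
    by rewrite lte_fin; near: t; exact: nbhs_left_lt.
  have [/(_ t Lt)[vt0 wt0] _ _ _] := flow; split=> //.
  have [_ _ ->] := vwP t Lt; have g0 := slope_gt0 v00 slope2 (w t).
  rewrite invfM invrK mulrA divff// mul1r lerDl.
  by rewrite mulr_ge0 ?sqr_ge0// ltW.
Unshelve. all: by end_near. Qed.

End BlowupFlow.

(** * The theorem *)

Theorem mainTheorem3 (R : realType) :
  (* (i) *)
  (forall (nu : R) (J : set R) (x0 : R) (v w : R -> R),
     0 < nu -> is_interval J -> pole_flow nu J v w ->
     [/\ forall x t, J t ->
           (omega_pole x0 v w x t)%:C%C = omega_cplx x0 (v t) (w t) x /\
           (u_pole x0 v w x t)%:C%C = u_cplx x0 (v t) (w t) x,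
         is_solution nu J (omega_pole x0 v w) (u_pole x0 v w),
         forall t, J t ->
           norm_Loo (omega_pole x0 v w ^~ t)
           = (3 * Num.sqrt 3 / 4 * (`|Omega v w t| / v t))%:E &
         forall t, J t ->
           norm_L2 (omega_pole x0 v w ^~ t)
           = (Num.sqrt pi * (`|Omega v w t| / Num.sqrt (v t)))%:E])
  /\
  (* (ii) *)
  (forall x0 v0 w0 : R, 0 < v0 -> w0 != 0 ->
     (2 < w0 / v0 ->
        exists (tc : R) (v w : R -> R),
          [/\ 0 < tc,
              maximal_pole_flow 1 tc%:E v0 w0 v w,
              is_solution 1 (lifespan tc%:E)
                (omega_pole x0 v w) (u_pole x0 v w),
              v t @[t --> tc^'-] --> 0 /\
              blows_up_at (omega_pole x0 v w) tc &
              exists vt : R,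
                [/\ 0 < vt,
                    v ~_(tc^'-) (fun t => vt * (tc - t) `^ (1 / 3)) &
                    w ~_(tc^'-)
                      (fun t => 4 * vt ^+ 2 / 3 * (tc - t) `^ (- (1 / 3)))]])
     /\
     (w0 / v0 <= 2 ->
        exists v w : R -> R,
          [/\ maximal_pole_flow 1 +oo%E v0 w0 v w,
              is_solution 1 (lifespan +oo%E)
                (omega_pole x0 v w) (u_pole x0 v w),
              forall t x, 0 < t ->
                real_analytic_at (omega_pole x0 v w ^~ t) x &
              forall s t, 0 <= s -> s < t -> v s < v t]))
  /\
  (* (iii) *)
  (forall eps : R, 0 < eps ->
     exists x0 v0 w0 : R,
       [/\ 0 < v0, w0 != 0,
           (norm_L2 (omega_prof x0 v0 w0) < eps%:E)%E,
           (norm_Loo (omega_prof x0 v0 w0) < eps%:E)%E &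
           exists (tc : R) (v w : R -> R),
             [/\ 0 < tc,
                 maximal_pole_flow 1 tc%:E v0 w0 v w,
                 is_solution 1 (lifespan tc%:E)
                   (omega_pole x0 v w) (u_pole x0 v w),
                 v t @[t --> tc^'-] --> 0 &
                 blows_up_at (omega_pole x0 v w) tc]]).
Proof.
split; [|split].
- move=> nu J x0 v w _ _ vw; have [vw0 _ _ _] := vw; split.
  + by move=> x t _; rewrite omega_pole_real u_pole_real.
  + exact: pole_solution.
  + by move=> t /vw0[vt0 _]; rewrite omega_poleE norm_Loo_omega.
  + by move=> t /vw0[vt0 _]; rewrite omega_poleE norm_L2_omega.
- move=> x0 v0 w0 v00 w00; split=> [slope2|slope2]; first exact: blowup_flow.
  have [v [w [vw vmono]]] := global_flow v00 w00 slope2.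
  have [flow _ _ _] := vw; exists v, w; split;
    [exact: vw|exact: pole_solution flow| |exact: vmono].
  move=> t x t0; have [vw0 _ _ _] := flow.
  have [vt0 _] : 0 < v t /\ w t != 0.
    by apply: vw0; split; [exact: ltW|rewrite ltry].
  by rewrite omega_poleE; exact: omega_real_analytic.
- move=> eps eps0.
  pose M : R := 3 * Num.sqrt 3 / 4 * 3 + Num.sqrt pi * 3.
  have s3 : 0 < Num.sqrt 3 :> R by rewrite sqrtr_gt0.
  have sp : 0 < Num.sqrt pi :> R by rewrite sqrtr_gt0 pi_gt0.
  (* [v0 = N^2] and [w0 / v0 = 3]: both norms are at most [M / N]. *)
  pose N := M / eps + 1.
  have M0 : 0 < M by rewrite /M; lra.
  have N1 : 1 < N by rewrite /N ltrDr divr_gt0.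
  have N0 : 0 < N by lra.
  have MN : M < eps * N by rewrite /N mulrDr mulrCA divff ?lt0r_neq0// mulr1; lra.
  have V0 : 0 < N ^+ 2 by rewrite exprn_gt0.
  have slope : 3 * N ^+ 2 / N ^+ 2 = 3 by rewrite mulfK// lt0r_neq0.
  exists 0, (N ^+ 2), (3 * N ^+ 2); split.
  + exact: V0.
  + by rewrite lt0r_neq0// mulr_gt0.
  + rewrite norm_L2_omega// lte_fin slope ger0_norm// sqrtr_sqr gtr0_norm//.
    by rewrite mulrA ltr_pdivrMr//; apply: le_lt_trans MN; rewrite /M; lra.
  + rewrite norm_Loo_omega// lte_fin slope ger0_norm// mulrA ltr_pdivrMr//.
    apply: (@le_lt_trans _ _ M); first by rewrite /M; lra.
    apply: (lt_trans MN); rewrite ltr_pM2l// expr2 ltr_pMr//.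
  + have [||tc [v [w [tc0 vw sol [v_0 blow] _]]]] := @blowup_flow R 0 (N ^+ 2) (3 * N ^+ 2).
    - exact: V0.
    - by rewrite slope; lra.
    by exists tc, v, w.
Qed.
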